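(* There is a polynomial-time algorithm which, given a graph $G$ and an edge $e\in E(G)$, decides whether $G$ has a $0$-perfect forest not containing $e$.
   Context: All graphs are finite and undirected, with no parallel edges or loops. A $0$-perfect forest of $G$ is a spanning forest $F$ of $G$ such that every tree (connected component) of $F$ is an induced subgraph of $G$ and every vertex has odd degree in $F$. *)

(* Defs.v *)
From mathcomp Require Import all_boot all_order all_algebra.

Set Implicit Arguments.
Unset Strict Implicit.
Unset Printing Implicit Defensive.

Record sgraph (T : finType) := SGraph {
  adj :> rel T;
  adj_sym : symmetric adj;
  adj_irrefl : irreflexive adj
}.

Section PerfectForest.
Variable T : finType.
Implicit Types (G F : sgraph T) (C : {set T}).

Definition degree G (x : T) : nat := #|[set y | G x y]|.

Definition spanning_subgraph F G : Prop := subrel F G.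

(* [ucycle] also accepts the back-and-forth traversal [:: x; y] of an edge,
   whence the bound 2. *)
Definition acyclic F : Prop := forall c : seq T, ucycle F c -> size c <= 2.

Definition component F C : Prop := exists x, C = [set y | connect F x y].

Definition component_induced F G C : Prop :=
  {in C &, forall x y, F x y = G x y}.

Definition zero_perfect_forest G F : Prop :=
  [/\ spanning_subgraph F G,
      acyclic F,
      forall C, component F C -> component_induced F G C
    & forall x, odd (degree F x)].

End PerfectForest.

(* Algorithms are programs for a random access machine with unit costs: finitely
   many registers are named by the program, and the memory cells, addressed
   indirectly, hold natural numbers. The only arithmetic operations are addition
   and truncated subtraction, so that t steps lengthen the numbers in use by O(t)
   bits, and polynomial time is the same notion as on Turing machines (a
   unit-cost multiplication would break this). *)
Inductive expr : Type :=
| ELit of nat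
| EReg of nat
| EMem of expr
| EAdd of expr & expr
| ESub of expr & expr.

Inductive cmd : Type :=
| CSet of nat & expr
| CStore of expr & expr
| CSeq of cmd & cmd
| CIf of expr & cmd & cmd
| CWhile of expr & cmd.

Record state := State { regs : nat -> nat; memory : nat -> nat }.

Definition update (f : nat -> nat) (i v : nat) : nat -> nat :=
  fun j => if j == i then v else f j.

Fixpoint eval_expr (s : state) (a : expr) : nat :=
  match a with
  | ELit k => k
  | EReg r => regs s r
  | EMem b => memory s (eval_expr s b)
  | EAdd b c => eval_expr s b + eval_expr s c
  | ESub b c => eval_expr s b - eval_expr s c
  end.

Fixpoint expr_cost (a : expr) : nat :=
  match a with
  | ELit _ | EReg _ => 1
  | EMem b => (expr_cost b).+1
  | EAdd b c | ESub b c => (expr_cost b + expr_cost c).+1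
  end.

(* [exec c s t s']: started in [s], the program [c] halts in [s'] after [t]
   steps. Nonzero test values count as true. *)
Inductive exec : cmd -> state -> nat -> state -> Prop :=
| ExecSet r a s :
    exec (CSet r a) s (expr_cost a).+1
      (State (update (regs s) r (eval_expr s a)) (memory s))
| ExecStore a b s :
    exec (CStore a b) s (expr_cost a + expr_cost b).+1
      (State (regs s) (update (memory s) (eval_expr s a) (eval_expr s b)))
| ExecSeq c1 c2 s1 s2 s3 t1 t2 :
    exec c1 s1 t1 s2 -> exec c2 s2 t2 s3 -> exec (CSeq c1 c2) s1 (t1 + t2) s3
| ExecIfTrue a c1 c2 s s' t :
    eval_expr s a != 0 -> exec c1 s t s' ->
    exec (CIf a c1 c2) s (expr_cost a + t).+1 s'
| ExecIfFalse a c1 c2 s s' t :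
    eval_expr s a = 0 -> exec c2 s t s' ->
    exec (CIf a c1 c2) s (expr_cost a + t).+1 s'
| ExecWhileStop a c s :
    eval_expr s a = 0 -> exec (CWhile a c) s (expr_cost a).+1 s
| ExecWhileStep a c s1 s2 s3 t1 t2 :
    eval_expr s1 a != 0 -> exec c s1 t1 s2 -> exec (CWhile a c) s2 t2 s3 ->
    exec (CWhile a c) s1 (expr_cost a + t1 + t2).+1 s3.

(* The input occupies the first memory cells, its length is in register 0, and
   everything else is 0. *)
Definition init_state (w : seq nat) : state :=
  State (update (fun=> 0) 0 (size w)) (nth 0 w).

(* The total number of bits of the input. *)
Definition input_size (w : seq nat) : nat :=
  \sum_(k <- w) (trunc_log 2 k).+1.

Definition accepting (s : state) : Prop := regs s 0 != 0.

Definition polytime_decidable (I : Type) (enc : I -> seq nat) (Q : I -> Prop) :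
    Prop :=
  exists (c : cmd) (p : {poly nat}), forall x : I, exists (t : nat) (s : state),
    [/\ exec c (init_state (enc x)) t s,
        t <= p.[input_size (enc x)]%R
      & accepting s <-> Q x].

Record graph_edge := GraphEdge {
  nb_vertices : nat;
  input_graph : sgraph 'I_nb_vertices;
  end1 : 'I_nb_vertices;
  end2 : 'I_nb_vertices;
  is_edge : input_graph end1 end2
}.

(* The number of vertices, the two ends of the edge, and the adjacency matrix by
   rows. *)
Definition encode_graph_edge (x : graph_edge) : seq nat :=
  [:: nb_vertices x; nat_of_ord (end1 x); nat_of_ord (end2 x)] ++
  [seq nat_of_bool (input_graph x i j) | i <- enum 'I_(nb_vertices x),
                                         j <- enum 'I_(nb_vertices x)].

(* Main.v *)
Require Import Defs.
From mathcomp Require Import all_boot all_order all_algebra zify.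

(* Let e = uv and let X be the component of u. A spanning subgraph with all
   degrees odd and the fewest edges is automatically a 0-perfect forest: a cycle,
   or a tree with a chord, could be exchanged for fewer edges without changing any
   parity. Odd spanning subgraphs exist exactly in the graphs all of whose
   components have even order, so the question is whether all components of G are
   even and X splits into two connected parts of even order, one containing u and
   the other v.

   Every vertex of X outside the block H of e hangs at one vertex of H; let w(h)
   be the number of vertices hanging at h, including h itself. Parts separating u
   and v are unions of hanging pieces, so if w(u) is odd and w(h) is even for all
   h <> u, v in H, the part of u is odd and no split exists. If w(u) is even, the
   piece of u can be split off. If w(h) is odd for some h <> u, v in H, two paths
   from u and v to h that meet only in h grow to a partition of X minus the piece
   of h into two connected parts, both adjacent to h; their orders have different
   parities, and adding the piece of h to the odd one makes both even. These
   conditions only involve the sets of vertices that remain reachable from e when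
   one vertex is deleted. *)

Set Implicit Arguments.
Unset Strict Implicit.
Unset Printing Implicit Defensive.

(** * Reachability inside a vertex set *)

Section Reach.
Variables (T : finType) (G : sgraph T).
Implicit Types (W S : {set T}) (s t x y : T).

Definition inside W : rel T := fun x y => [&& x \in W, y \in W & G x y].
Arguments inside W x y /.

(** [connect] is reflexive even at an [s] outside [W]; intersecting with [W] makes the set empty in
    that case. Connectedness of a set [A] containing [s] is written [A \subset reach A s] below. *)
Definition reach W s : {set T} := [set t in W | connect (inside W) s t].

Lemma reach_sub W s : reach W s \subset W.
Proof. by apply/subsetP => t; rewrite inE => /andP[]. Qed.

Lemma reach_self W s : s \in W -> s \in reach W s.
Proof. by move=> sW; rewrite inE sW connect0. Qed.

Lemma reach_step W s a b :
  a \in reach W s -> b \in W -> G a b -> b \in reach W s.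
Proof.
rewrite !inE => /andP[aW sa] bW ab; rewrite bW.
by apply: (connect_trans sa); apply: connect1; rewrite /= aW bW.
Qed.

Lemma reach_min W s S :
    (s \in W -> s \in S) ->
    (forall a b, a \in W -> b \in W -> a \in S -> G a b -> b \in S) ->
  reach W s \subset S.
Proof.
move=> sS clS; apply/subsetP => t; rewrite inE => /andP[tW /connectP[p]].
elim: p s sS => [|b p IHp] s sS /=; first by move=> _ ts; move: tW; rewrite ts.
case/andP=> /and3P[sW bW sb] bp; apply: IHp bp => _.
exact: clS (sS sW) sb.
Qed.

Lemma reach_src W s t : t \in reach W s -> s \in W.
Proof.
suff sub : reach W s \subset [set _ | s \in W] by move/(subsetP sub); rewrite inE.
by apply: reach_min => [|a b _ _]; rewrite !inE.
Qed.

Lemma reach_sym W s t : t \in reach W s -> s \in reach W t.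
Proof.
move=> ts; have sW := reach_src ts; move: ts; rewrite !inE => /andP[_].
rewrite sW (_ : connect_sym (inside W)) //.
by apply: sym_connect_sym => x y; rewrite /= adj_sym andbCA.
Qed.

Lemma reach_trans W s t x :
  t \in reach W s -> x \in reach W t -> x \in reach W s.
Proof.
by rewrite !inE => /andP[_ st] /andP[-> /(connect_trans st)].
Qed.

Lemma reach_mono W W' s : W \subset W' -> reach W s \subset reach W' s.
Proof.
move=> sWW'; apply: reach_min => [sW|a b _ bW].
  by rewrite reach_self ?(subsetP sWW').
by move=> aR ab; apply: reach_step aR _ ab; rewrite (subsetP sWW').
Qed.

(** A path from [s] inside [W] only meets vertices that it reaches, hence never [y]. *)
Lemma reach_avoid W s y :
  y \notin reach W s -> reach W s \subset reach (W :\ y) s.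
Proof.
move=> yR; suff: reach W s \subset reach W s :&: reach (W :\ y) s.
  by rewrite subsetI => /andP[].
apply: reach_min => [sW|a b aW bW].
  rewrite in_setI !reach_self // !inE sW andbT.
  by apply: contraNneq yR => <-; rewrite reach_self.
case/setIP=> aR aR' ab; have bR := reach_step aR bW ab.
rewrite in_setI bR; apply: reach_step aR' _ ab; rewrite !inE bW andbT.
by apply: contraNneq yR => <-.
Qed.

Lemma reach_idem W s : reach W s \subset reach (reach W s) s.
Proof.
apply: reach_min => [sW|a b aW bW aR ab]; first by rewrite !reach_self.
have aR' := subsetP (reach_sub _ _) _ aR.
by apply: (reach_step aR _ ab); apply: reach_step aR' bW ab.
Qed.

(** Without such an [a], the set reached inside [W :\ h] would be closed under all edges inside [W],
    and [h] would not be reached. *)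
Lemma reach_exit W s h :
  s \in W :\ h -> h \in reach W s -> exists2 a, a \in reach (W :\ h) s & G a h.
Proof.
move=> sW hR; apply/exists_inP; apply: contraLR hR => /exists_inPn noexit.
suff /subsetP sub: reach W s \subset reach (W :\ h) s.
  by apply/negP => /sub; rewrite !inE eqxx.
apply: reach_min => [_|a b aW bW aR ab]; first exact: reach_self.
apply: (reach_step aR _ ab); rewrite !inE bW andbT.
by apply: contraTneq ab => ->; apply: noexit.
Qed.

Lemma reach_add (A : {set T}) s a b :
  A \subset reach A s -> a \in A -> G a b -> b |: A \subset reach (b |: A) s.
Proof.
move=> cA aA ab; have sub := subset_trans cA (reach_mono s (subsetUr [set b] A)).
rewrite subUset sub sub1set andbT.
by apply: reach_step (subsetP sub _ aA) _ ab; rewrite !inE eqxx.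
Qed.

End Reach.

(** * Parities of degrees, joins, and odd subgraphs with few edges *)

Lemma odd_sum_bool (I : finType) (P : pred I) (f : I -> nat) :
  odd (\sum_(i | P i) f i) = \big[addb/false]_(i | P i) odd (f i).
Proof. by rewrite (big_morph odd oddD (erefl _)). Qed.

Section Joins.
Variable T : finType.
Implicit Types (F G D : sgraph T) (x y z : T).

Lemma odd_degree F x : odd (degree F x) = \big[addb/false]_y F x y.
Proof.
rewrite /degree -sum1_card big_mkcond odd_sum_bool.
by apply: eq_bigr => y _; rewrite inE; case: (F x y).
Qed.

Definition symdiff_rel F D : rel T := fun x y => F x y (+) D x y.
Arguments symdiff_rel F D x y /.

Lemma symdiff_sym F D : symmetric (symdiff_rel F D).
Proof. by move=> x y; rewrite /= adj_sym (adj_sym D). Qed.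

Lemma symdiff_irrefl F D : irreflexive (symdiff_rel F D).
Proof. by move=> x; rewrite /= !adj_irrefl. Qed.

Definition symdiff F D : sgraph T := SGraph (symdiff_sym F D) (symdiff_irrefl F D).

Lemma odd_degree_symdiff F D x :
  odd (degree (symdiff F D) x) = odd (degree F x) (+) odd (degree D x).
Proof. by rewrite !odd_degree -big_split. Qed.

(** The guard [x != y] makes [edge x x] the empty graph, which keeps the relation irreflexive and
    starts the induction in [connect_join]. *)
Definition edge_rel x y : rel T :=
  fun a b => (x != y) && ((a == x) && (b == y) || (a == y) && (b == x)).
Arguments edge_rel x y a b /.

Lemma edge_sym x y : symmetric (edge_rel x y).
Proof. by move=> a b; rewrite /= orbC [(a == y) && _]andbC [(a == x) && _]andbC. Qed.

Lemma edge_irrefl x y : irreflexive (edge_rel x y).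
Proof.
move=> a /=; rewrite [(a == y) && _]andbC orbb.
by have [->|] := eqVneq a x; case: (x == y).
Qed.

Definition edge x y : sgraph T := SGraph (@edge_sym x y) (@edge_irrefl x y).

Lemma odd_degree_edge x y z : odd (degree (edge x y) z) = (z == x) (+) (z == y).
Proof.
rewrite odd_degree /=; have [->|xy] /= := eqVneq x y; first by rewrite addbb big1.
have [->|zx] := eqVneq z x.
  rewrite (negPf xy) /= (bigD1 y) //= eqxx big1 // => b /negPf.
  by rewrite orbF.
have [_|zy] := eqVneq z y; last by rewrite big1.
by rewrite (bigD1 x) //= eqxx big1 // => b /negPf.
Qed.

Lemma edge_sub F x y : F x y -> subrel (edge x y) F.
Proof.
move=> xy a b /= /andP[_ /orP[]] /andP[/eqP-> /eqP->] //.
by rewrite adj_sym.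
Qed.

Lemma symdiff_sub F D G : subrel F G -> subrel D G -> subrel (symdiff F D) G.
Proof.
by move=> FG DG x y /=; case: (boolP (F x y)) => [/FG|_ /DG].
Qed.

(** Adding the edges of a walk modulo 2 cancels the inner vertices: [D] is a join of [x] and [y],
    with all degrees even when [x = y]. *)
Lemma connect_join F x y : connect F x y ->
  exists2 D : sgraph T, subrel D F &
    forall z, odd (degree D z) = (z == x) (+) (z == y).
Proof.
case/connectP=> p; elim: p x => [|b p IHp] x /=.
  move=> _ ->; exists (edge x x) => [a c /=|z]; first by rewrite eqxx.
  by rewrite odd_degree_edge.
case/andP=> xb bp /(IHp _ bp)[D DF Dz]; exists (symdiff (edge x b) D).
  exact: symdiff_sub (edge_sub xb) DF.
by move=> z; rewrite odd_degree_symdiff Dz odd_degree_edge addbA addbK.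
Qed.

Lemma handshake F (K : {set T}) :
    (forall x y, x \in K -> F x y -> y \in K) ->
  odd #|[set x in K | odd (degree F x)]| = false.
Proof.
move=> clK; have -> : odd #|[set x in K | odd (degree F x)]|
    = odd (\sum_(x in K) \sum_(y in K) F x y).
  rewrite -sum1_card (eq_bigl (fun x => (x \in K) && odd (degree F x))); last first.
    by move=> x; rewrite inE.
  rewrite big_mkcondr !odd_sum_bool; apply: eq_bigr => x xK.
  have -> (b : bool) : odd (if b then 1 else 0) = b by case: b.
  rewrite odd_sum_bool odd_degree (bigID (mem K)) /= addbC big1 => [|y].
    by rewrite addFb; apply: eq_bigr => y _; case: (F x y).
  by apply: contraNF; apply: clK.
(* Arcs are split by whether the rank increases or decreases; exchanging the summations shows that
   both halves are equal. *)
rewrite (eq_bigr (fun x => \sum_(y in K) (F x y && (enum_rank x < enum_rank y)) +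
    \sum_(y in K) (F y x && (enum_rank y < enum_rank x)))); last first.
  move=> x xK; rewrite -big_split; apply: eq_bigr => y yK /=.
  rewrite (adj_sym F y); case Fxy: (F x y) => //=.
  case: ltngtP => // /ord_inj/enum_rank_inj xy.
  by rewrite xy adj_irrefl in Fxy.
by rewrite big_split /= [X in _ + X]exchange_big addnn odd_double.
Qed.

(** Ordered pairs are counted, so this is twice the number of edges. *)
Definition nb_arcs F := #|[set p : T * T | F p.1 p.2]|.

Lemma nb_arcs_lt F F' x y :
  subrel F F' -> F' x y -> ~~ F x y -> nb_arcs F < nb_arcs F'.
Proof.
move=> FF' xy nxy; apply: proper_card; apply/properP; split.
  by apply/subsetP => p; rewrite !inE => /FF'.
by exists (x, y); rewrite inE.
Qed.

(** Induction on the number of vertices of even degree, from the empty graph [symdiff G G]: a join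
    of two such vertices in one component of [G] makes both odd and changes no other parity. *)
Lemma odd_spanning_subgraph G :
    (forall x, ~~ odd #|[set y | connect G x y]|) ->
  exists2 F : sgraph T, subrel F G & forall x, odd (degree F x).
Proof.
move=> evG; have [F FG] : exists2 F : sgraph T,
    subrel F G & #|[set x | ~~ odd (degree F x)]| <= #|T|.
  exists (symdiff G G); last exact: max_card.
  by move=> x y /=; rewrite addbb.
move: #|T| => m; elim: m F FG => [|m IHm] F FG Fm.
  exists F => // x; move: Fm; rewrite leqn0 cards_eq0 => /eqP/setP/(_ x).
  by rewrite !inE => /negbFE.
have [F0|] := set_0Vmem [set x | ~~ odd (degree F x)].
  by apply: (IHm F); rewrite // F0 cards0.
case=> x; rewrite inE => xev.
pose K := [set y | connect G x y].
have clK a b : a \in K -> F a b -> b \in K.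
  by rewrite !inE => xa /FG/connect1/(connect_trans xa).
(* If [x] were the only vertex of even degree in [K], the others would be even in number by
   [handshake], and [#|K|] would be odd. *)
have [y yK] : exists2 y, y \in K & (y != x) && ~~ odd (degree F y).
  apply/exists_inP; apply: contraLR (evG x) => /exists_inPn none; rewrite negbK -/K.
  rewrite (cardsD1 x) inE connect0 oddD /=.
  have := handshake clK; rewrite (_ : [set _ in _ | _] = K :\ x) => [->//|].
  apply/setP => y; rewrite !inE.
  have [->|yx] := eqVneq y x; first by rewrite (negPf xev) andbF.
  case xy: (connect G x y) => //=; have := none y; rewrite inE xy => /(_ isT).
  by rewrite yx negbK.
case/andP=> yx yev; move: yK; rewrite inE => /connect_join[D DG Dz].
apply: (IHm (symdiff F D)); first exact: symdiff_sub.
rewrite -ltnS (leq_trans _ Fm) //; apply: proper_card.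
apply/properP; split; last first.
  exists x; rewrite !inE // odd_degree_symdiff Dz eqxx [x == y]eq_sym (negPf yx).
  by rewrite (negPf xev).
apply/subsetP => z; rewrite !inE odd_degree_symdiff Dz.
have [->|zx] := eqVneq z x; first by [].
by have [->|zy] := eqVneq z y; rewrite ?addbF.
Qed.

(** Removing an edge [x y] from a cycle with at least three vertices leaves the rest of the cycle as
    a path between its ends; for an edge of [F], the symmetric difference with [edge x y] is that
    removal. *)
Lemma acyclicP F :
    (forall x y, F x y -> ~~ connect (symdiff F (edge x y)) x y) ->
  acyclic F.
Proof.
move=> nocyc [|x [|y [|z p]]] //= /andP[/= /and3P[xy yz zp] /and3P[xN yN zN]].
case/negP: (nocyc _ _ xy); rewrite (sym_connect_sym (adj_sym _)).
apply/connectP; exists (z :: rcons p x); last by rewrite /= last_rcons.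
move: xN yN zp; rewrite !inE !negb_or => /and3P[nxy nxz xp] /andP[nyz yp] pth.
have keep a b : F a b -> (a != x) && (a != y) || (b != x) && (b != y) ->
    symdiff F (edge x y) a b.
  move=> /= ->; case: (a == x); case: (a == y); case: (b == x); case: (b == y);
  by rewrite ?andbF.
move: nxz nyz; rewrite eq_sym => nzx; rewrite eq_sym => nzy.
apply/andP; split; first by apply: keep; rewrite ?nzx ?nzy ?orbT.
elim: p z {yz zN} nzx nzy xp yp pth => [|b p IHp] z nzx nzy.
  by move=> _ _ /andP[zx _]; apply/andP; split=> //; apply: keep; rewrite ?nzx ?nzy.
rewrite !inE !negb_or => /andP[nxb xp] /andP[nyb yp] /andP[zb bp].
apply/andP; split; first by apply: keep; rewrite ?nzx ?nzy.
by apply: IHp; rewrite // eq_sym.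
Qed.

(* Induction on the number of edges: an edge xy of a cycle is removed together with
   an odd join of x and y avoiding it, and a chord xy of a tree replaces such a
   join, which has at least two edges. *)
Lemma perfect_forest_below G G' F :
    subrel G' G -> (forall x y, connect G' x y -> G x y -> G' x y) ->
    subrel F G' -> (forall x, odd (degree F x)) ->
  exists2 F' : sgraph T, subrel F' G' & zero_perfect_forest G F'.
Proof.
move=> G'G indG'; have [m] := ubnP (nb_arcs F); elim: m F => // m IHm F Fm FG' Fodd.
have csym (H : sgraph T) : connect_sym H by apply/sym_connect_sym/adj_sym.
have [/existsP[x /existsP[y /andP[xy]]]|] :=
    boolP [exists x, exists y, F x y && connect (symdiff F (edge x y)) x y].
  case/connect_join=> D DF Dz; pose F' := symdiff (symdiff F (edge x y)) D.
  have subF : subrel (symdiff F (edge x y)) F.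
    by apply: symdiff_sub => //; apply: edge_sub.
  have xNy : x != y by apply: contraTneq xy => ->; rewrite adj_irrefl.
  apply: (IHm F').
  - rewrite -ltnS (leq_trans _ Fm) // ltnS; apply: (@nb_arcs_lt _ _ x y) => //.
      by apply: symdiff_sub => // a b /DF/subF.
    rewrite [F' x y]/= xy !eqxx xNy /=; apply/negP => /DF.
    by rewrite /= xy !eqxx xNy.
  - by apply: symdiff_sub => [a b /subF/FG'|a b /DF/subF/FG'].
  by move=> z; rewrite 2!odd_degree_symdiff Dz odd_degree_edge Fodd addbK.
move=> /existsPn acyc.
have [/existsP[x /existsP[y /and3P[cxy Gxy nxy]]]|/existsPn ind] :=
    boolP [exists x, exists y, [&& connect F x y, G x y & ~~ F x y]].
  have G'xy : G' x y.
    by apply: indG' => //; apply: connect_sub cxy => a b /FG'/connect1.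
  have [D DF Dz] := connect_join cxy.
  pose F1 := symdiff F D; pose F' := symdiff F1 (edge x y).
  have F1F : subrel F1 F by apply: symdiff_sub.
  have xNy : x != y by apply: contraTneq Gxy => ->; rewrite adj_irrefl.
  apply: (IHm F').
  - rewrite -ltnS (leq_trans _ Fm) // ltnS.
    pose A := [set p : T * T | F p.1 p.2].
    pose B := [set p : T * T | D p.1 p.2].
    have BA : B \subset A by apply/subsetP => p; rewrite !inE => /DF.
    (* The chord contributes two arcs, so three arcs of the join suffice: an edge [x z], with
       [z != y] as [F] lacks [x y], counts in both directions, and [z], of even degree in [D], has a
       second neighbour [w]. *)
    have B3 : 2 < #|B|.
      have [z xz] : exists z, D x z.
        apply/existsP; have := Dz x; rewrite eqxx (negPf xNy) odd_degree.
        apply: contra_eqT => /existsPn none.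
        by rewrite big1 // => z _; apply: negPf (none z).
      have zx : z != x by apply: contraTneq xz => ->; rewrite adj_irrefl.
      have zy : z != y by apply: contraTneq xz => ->; apply: contra nxy => /DF.
      have [w zw wx] : exists2 w, D z w & w != x.
        apply/exists_inP; have := Dz z; rewrite (negPf zx) (negPf zy) odd_degree.
        apply: contraFT => /exists_inPn none; rewrite (bigD1 x) //= adj_sym xz.
        by rewrite big1 // => w; apply: contraNF => zw; exact: negbNE (none w zw).
      rewrite -(_ : #|[set (x, z); (z, x); (z, w)]| = 3).
        apply: subset_leq_card; apply/subsetP => p; rewrite !inE.
        by do 2?[case/orP] => /eqP-> //=; rewrite adj_sym.
      rewrite setUC cardsU1 cards2 !inE !xpair_eqE (negPf zx) (negPf wx).
      by rewrite (eq_sym x) (negPf zx) andbF.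
    have -> : nb_arcs F = #|B| + #|A :\: B|.
      by rewrite -[nb_arcs F](cardsID B A) (setIidPr BA).
    apply: leq_ltn_trans (_ : 2 + #|A :\: B| < _); last by rewrite ltn_add2r.
    apply: leq_trans (_ : #|[set (x, y); (y, x)] :|: (A :\: B)| <= _).
      apply: subset_leq_card; apply/subsetP => -[a b]; rewrite !inE !xpair_eqE /=.
      case: (_ && _ || _); rewrite ?andbF ?addbF //= => Fab.
      by case: (boolP (D a b)) Fab => [/DF ->|_]; rewrite ?addbF.
    by rewrite (leq_trans (leq_card_setU _ _)) // leq_add2r cards2 ltnS leq_b1.
  - by apply: symdiff_sub (edge_sub G'xy) => a b /F1F/FG'.
  by move=> z; rewrite 2!odd_degree_symdiff Dz odd_degree_edge Fodd addbK.
exists F => //; split=> //; first by move=> x y /FG'/G'G.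
  apply: acyclicP => x y xy; apply/negP => cxy.
  by case/negP: (acyc x); apply/existsP; exists y; rewrite xy.
move=> C [r ->] x y; rewrite !inE => rx ry; apply/idP/idP => [/FG'/G'G //|Gxy].
apply/negPn/negP => nxy; case/negP: (ind x); apply/existsP; exists y.
by rewrite Gxy nxy (connect_trans _ ry) // csym.
Qed.

End Joins.

(** * Graphs with a 0-perfect forest avoiding a given edge *)

Section Characterization.
Variables (T : finType) (G : sgraph T) (u v : T).
Hypothesis uv : G u v.
Implicit Types (F : sgraph T) (A B W S K : {set T}) (h s x y z : T).

Let X := reach G setT u.

(** For [y] in [X], the complement in [X] consists of [y] and all that [y] separates from the edge
    [uv]. One of the two sets is empty when [y] is [u] or [v]. *)
Definition reach2 y : {set T} := reach G [set~ y] u :|: reach G [set~ y] v.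

(* h lies in the block of the edge uv: no other vertex separates h from it. *)
Definition in_block h := [forall y, (y != h) ==> (h \in reach2 y)].

Definition even_components := [forall s, ~~ odd #|reach G setT s|].

(** When [#|X|] is even, [reach2 h] has the parity of w(h), the order of its complement in [X]. If
    w(u) is odd and w(h) is even at every other block vertex except [v], then w(v) is odd too, so
    testing [u] covers both ends. *)
Definition avoidable :=
  ~~ odd #|reach2 u| ||
  [exists h, [&& h != u, h != v, odd #|reach2 h| & in_block h]].

Let uNv : u != v. Proof. by apply: contraTneq uv => ->; rewrite adj_irrefl. Qed.

Let X_closed a b : a \in X -> G a b -> b \in X.
Proof. by move=> aX; apply: reach_step aX _; rewrite inE. Qed.

Let uX : u \in X. Proof. by rewrite reach_self ?inE. Qed.
Let vX : v \in X. Proof. exact: X_closed uX uv. Qed.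

Let X_min S :
  u \in S -> (forall a b, a \in S -> G a b -> b \in S) -> X \subset S.
Proof. by move=> uS clS; apply: reach_min => // a b _ _; apply: clS. Qed.

Lemma reach2_sub y : reach2 y \subset X.
Proof.
rewrite subUset reach_mono ?subsetT //=.
by apply: reach_min => [_|a b _ _]; [exact: vX | exact: X_closed].
Qed.

Lemma reach2_step y a b : a \in reach2 y -> b != y -> G a b -> b \in reach2 y.
Proof.
move=> aR byN ab; have bW : b \in [set~ y] by rewrite !inE.
by case/setUP: aR => aR; apply/setUP; [left|right]; apply: reach_step aR bW ab.
Qed.

Lemma reach2_min y S :
    (u != y -> u \in S) -> (v != y -> v \in S) ->
    (forall a b, a \in S -> b != y -> G a b -> b \in S) ->
  reach2 y \subset S.
Proof.
move=> uS vS clS; rewrite subUset.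
by apply/andP; split; apply: reach_min; rewrite ?inE // => a b _;
  rewrite !inE => bW aS; apply: clS.
Qed.

Lemma reach2_self y : y \notin reach2 y.
Proof.
by apply/setUP => -[] /(subsetP (reach_sub _ _ _)); rewrite !inE eqxx.
Qed.

Lemma reach2_u y : u != y -> u \in reach2 y.
Proof. by move=> uy; rewrite inE reach_self // !inE. Qed.

Lemma reach2_v y : v != y -> v \in reach2 y.
Proof. by move=> vy; rewrite inE orbC reach_self // !inE. Qed.

Lemma reach2_avoid y z : y \notin reach2 z -> reach2 z \subset reach2 y.
Proof.
have sub : [set~ z] :\ y \subset [set~ y].
  by apply/subsetP => x; rewrite !inE => /andP[].
rewrite inE negb_or => /andP[yu yv]; apply: setUSS.
  exact: subset_trans (reach_avoid yu) (reach_mono _ _ sub).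
exact: subset_trans (reach_avoid yv) (reach_mono _ _ sub).
Qed.

(** If each of two distinct vertices were cut off by the other, their sets [reach2] would agree by
    [reach2_avoid]; the common set would be closed under all edges and contain all of [X], even
    [y]. *)
Lemma reach2_asym y z : y \in X -> y != z -> y \notin reach2 z -> z \in reach2 y.
Proof.
move=> yX yz yR; apply: contraLR yX => zR.
have eqR : reach2 z = reach2 y by apply/eqP; rewrite eqEsubset !reach2_avoid.
apply: contra yR => yX; apply: subsetP yX; apply: X_min => [|a b aR ab].
  have [uz|/reach2_u//] := eqVneq u z.
  by rewrite eqR reach2_u // uz eq_sym.
have [bz|bz] := eqVneq b z; last exact: reach2_step ab.
by case/negP: zR; rewrite -bz; apply: reach2_step ab; rewrite -?eqR // bz eq_sym.
Qed.

(** A step from [reach2 h] to the deleted vertex [h] lands in [reach2 h'], and conversely, so the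
    union is closed under all edges. *)
Lemma reach2_cover h h' :
  h != h' -> h \in reach2 h' -> h' \in reach2 h -> X \subset reach2 h :|: reach2 h'.
Proof.
move=> hh' hR h'R; apply: X_min => [|a b].
  by apply/setUP; have [->|/reach2_u] := eqVneq u h; [right|left].
case/setUP=> aR ab; apply/setUP.
  by have [->|bh] := eqVneq b h; [right|left; apply: reach2_step ab].
by have [->|bh] := eqVneq b h'; [left|right; apply: reach2_step ab].
Qed.

(** Among the vertices of [X] that cut [x] off, [x] included, one with the largest cut-off part is
    taken; a vertex [y] cutting it off in turn would have a strictly larger part. *)
Lemma block_cover x : x \in X -> exists2 h, in_block h & x \in X :\: reach2 h.
Proof.
move=> xX; pose P h := (h \in X) && (x \notin reach2 h).
have Px : P x by rewrite /P xX reach2_self.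
case: (arg_maxnP (fun h => #|X :\: reach2 h|) Px) => h /andP[hX xh] hmax.
exists h; last by rewrite in_setD xh.
apply/forallP => y; apply/implyP => yh; apply/negPn/negP => hR.
have yR : y \in reach2 h by apply: reach2_asym => //; rewrite eq_sym.
have yX := subsetP (reach2_sub _) _ yR.
have sub := reach2_avoid hR.
have /hmax : P y by rewrite /P yX (contra (subsetP sub x)).
rewrite /geq /= leqNgt => /negP[]; apply: proper_card.
apply/properP; split; first exact: setDS.
by exists y; rewrite !in_setD ?yX ?reach2_self ?yR.
Qed.

Lemma block_sub h : in_block h -> h \in X.
Proof.
move=> /forallP hH; have [hu|uh] := eqVneq u h; first by rewrite -hu.
by have := hH u; rewrite uh => /(subsetP (reach2_sub _)).
Qed.

(** With [block_cover], this makes the pieces hanging at the block vertices a partition of [X]. *)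
Lemma block_disjoint h h' :
  in_block h -> in_block h' -> h != h' -> [disjoint X :\: reach2 h & X :\: reach2 h'].
Proof.
move=> /forallP/(_ h')/implyP hH /forallP/(_ h)/implyP h'H hh'.
have /subsetP cov : X \subset reach2 h :|: reach2 h'.
  by apply: reach2_cover => //; [apply: hH; rewrite eq_sym | apply: h'H].
rewrite -setI_eq0; apply/eqP/setP => x; rewrite in_setI !in_setD in_set0; apply/negP.
case/andP=> /andP[xh xX] /andP[xh' _].
by have := cov x xX; rewrite in_setU (negPf xh) (negPf xh').
Qed.

Lemma card_outside h : ~~ odd #|X| -> odd #|X :\: reach2 h| = odd #|reach2 h|.
Proof.
rewrite -(cardsID (reach2 h) X) (setIidPr (reach2_sub h)) oddD.
by case: (odd _); case: (odd _).
Qed.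

Lemma forest_closed_even F K :
    zero_perfect_forest G F -> (forall x y, x \in K -> F x y -> y \in K) ->
  ~~ odd #|K|.
Proof.
case=> _ _ _ Fodd clK; apply/negbT; rewrite -[RHS](handshake clK).
congr (odd #|pred_of_set _|).
by apply/setP => x; rewrite inE Fodd andbT.
Qed.

(** The tree [C] of [u] is induced and lacks the edge [uv], so it misses [v]. The pieces hanging at
    block vertices in [C] form a set closed under [F], hence of even order, whereas if [avoidable]
    fails only the piece of [u] is odd. *)
Lemma forest_avoidable F :
  zero_perfect_forest G F -> ~~ F u v -> even_components && avoidable.
Proof.
move=> FP Fuv; have [FG _ Find Fodd] := FP.
have evX s : ~~ odd #|reach G setT s|.
  by apply: forest_closed_even FP _ => x y xR /FG; apply: reach_step xR _; rewrite inE.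
rewrite /even_components; have -> /= : [forall s, ~~ odd #|reach G setT s|].
  exact/forallP.
apply/negPn/negP; rewrite negb_or negbK => /andP[uodd /existsPn hev].
pose C := [set y | connect F u y].
have vC : v \notin C.
  have FC : component F C by exists u.
  apply: contra Fuv => vC; rewrite (Find C FC) //.
  by rewrite inE connect0.
pose H h := (h \in C) && in_block h.
pose P h := if H h then X :\: reach2 h else set0.
(* An edge of [F] leaves the piece of [h] only at [h] itself; its other end [y] is then a block
   vertex, and lies in [C] with [h]. *)
have clS x y : x \in \bigcup_h P h -> F x y -> y \in \bigcup_h P h.
  case/bigcupP=> h _; rewrite /P; case: ifP => [Hh|]; last by rewrite inE.
  case/setDP=> xX xh Fxy; have yX := X_closed xX (FG _ _ Fxy).
  have [yR|yR] := boolP (y \in reach2 h); last first.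
    by apply/bigcupP; exists h; rewrite // Hh in_setD yR.
  have xeq : x = h.
    apply/eqP; apply: contraNT xh => xh; apply: reach2_step yR xh _.
    by rewrite adj_sym; apply: FG.
  have [h' Bh' yh'] := block_cover yX.
  have hh' : h' != h by apply: contraTneq yh' => ->; rewrite in_setD yR.
  have yeq : y = h'.
    apply/eqP; move: yh'; rewrite in_setD yX andbT; apply: contraNT => yh'.
    apply: (@reach2_step _ x) => //; last exact: FG.
    case/andP: Hh => _ /forallP/(_ h'); rewrite hh' xeq /=; exact.
  apply/bigcupP; exists h' => //; rewrite /H Bh' andbT -yeq.
  case/andP: Hh; rewrite -xeq !inE => ux _.
  by rewrite (connect_trans ux (connect1 Fxy)) in_setD yX reach2_self.
have := forest_closed_even FP clS.
rewrite -sum1_card (partition_disjoint_bigcup) => [|i j ij]; last first.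
  rewrite /P; case: ifP => [/andP[_ Hi]|_]; last by rewrite -setI_eq0 set0I.
  case: ifP => [/andP[_ Hj]|_]; last by rewrite -setI_eq0 setI0.
  exact: block_disjoint.
rewrite odd_sum_bool (bigD1 u) //= [X in _ (+) X]big1 => [|h hu]; last first.
  rewrite sum1_card /P; case: ifP => [/andP[hC hH]|_]; last by rewrite cards0.
  apply/negbTE; rewrite card_outside; last exact: evX.
  have := hev h; rewrite hu hH.
  by rewrite (_ : h != v) ?andbT //; apply: contraNneq vC => <-.
rewrite sum1_card /P /H inE connect0 /=.
have -> : in_block u by apply/forallP => y; apply/implyP => yu; rewrite reach2_u // eq_sym.
by rewrite card_outside ?uodd //; apply: evX.
Qed.

(** [G'] drops the edges of [G] between [A] and the other vertices. Its components are [A], [B] and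
    the components of [G] other than [X], all of even order, and a forest inside [G'] cannot use
    [uv]. *)
Lemma forest_of_split A B :
    even_components -> u \in A -> v \in B -> [disjoint A & B] -> A :|: B = X ->
    A \subset reach G A u -> B \subset reach G B v -> ~~ odd #|A| ->
  exists2 F, zero_perfect_forest G F & ~~ F u v.
Proof.
move=> /forallP evG uA vB dAB AB cA cB evA.
have evB : ~~ odd #|B|.
  have := evG u; rewrite -/X -AB cardsU disjoint_setI0 // cards0 subn0 oddD.
  by rewrite (negPf evA).
pose r : rel T := fun x y => G x y && ((x \in A) == (y \in A)).
have r_sym : symmetric r by move=> x y; rewrite /r adj_sym eq_sym.
have r_irr : irreflexive r by move=> x; rewrite /r adj_irrefl.
pose G' := SGraph r_sym r_irr.
have G'G : subrel G' G by move=> x y /andP[].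
have csym : connect_sym G' by apply/sym_connect_sym.
have vA : v \notin A by rewrite (disjointFl dAB).
have inA x y : connect G' x y -> (x \in A) = (y \in A).
  case/connectP=> p; elim: p x => [|z p IHp] x /=; first by move=> _ ->.
  by case/andP=> /andP[_ /eqP->] /IHp.
have inX x y : connect G' x y -> (x \in X) = (y \in X).
  case/connectP=> p; elim: p x => [|z p IHp] x /=; first by move=> _ ->.
  case/andP=> /andP[xz _] /IHp ih /ih <-.
  by apply/idP/idP => ?; [apply: X_closed xz|apply: X_closed (_ : G z x)]; rewrite // adj_sym.
have con W s t : {in W &, forall x y, (x \in A) = (y \in A)} ->
    t \in reach G W s -> connect G' s t.
  move=> WA; rewrite inE => /andP[_]; apply: connect_sub => x y /and3P[xW yW xy].
  by apply: connect1; rewrite /= /r xy (WA x y) ?eqxx.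
have BA x : x \in B -> x \in A = false by apply: disjointFl.
have inB x : x \in X -> x \notin A -> x \in B by rewrite -AB inE => /orP[->|].
have evG' x : ~~ odd #|[set y | connect G' x y]|.
  have [xA|xA] := boolP (x \in A).
    rewrite (_ : [set y | _] = A) //; apply/setP => y; rewrite inE.
    apply/idP/idP => [/inA <- //|yA].
    have cuA z : z \in A -> connect G' u z.
      by move=> /(subsetP cA); apply: con => a b -> ->.
    by apply: connect_trans (cuA y yA); rewrite csym cuA.
  have [xX|xX] := boolP (x \in X).
    have xB := inB x xX xA.
    rewrite (_ : [set y | _] = B) //; apply/setP => y; rewrite inE.
    apply/idP/idP => [xy|yB].
      by apply: inB; rewrite -?(inX _ _ xy) -?(inA _ _ xy).
    have cvB z : z \in B -> connect G' v z.
      by move=> /(subsetP cB); apply: con => a b /BA-> /BA->.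
    by apply: connect_trans (cvB y yB); rewrite csym cvB.
  rewrite (_ : [set y | _] = reach G setT x) //; apply/eqP; rewrite eqEsubset.
  apply/andP; split.
    apply/subsetP => y; rewrite !inE; apply: connect_sub => a b /G'G ab.
    by apply: connect1; rewrite /inside !in_setT.
  pose S := [set y | (y \notin X) && connect G' x y].
  have SE y : (y \in S) = (y \notin X) && connect G' x y by rewrite [LHS]in_set.
  suff: reach G setT x \subset S.
    by move/subset_trans; apply; apply/subsetP => y; rewrite SE inE => /andP[].
  apply: reach_min => [_|a b _ _]; rewrite !SE; first by rewrite xX connect0.
  case/andP=> aX xa ab; have bX : b \notin X.
    by apply: contra aX => bX; apply: X_closed bX _; rewrite adj_sym.
  rewrite bX; apply: connect_trans xa (connect1 _); rewrite /= /r ab.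
  have XA z : z \notin X -> z \in A = false.
    by rewrite -AB inE negb_or => /andP[/negPf].
  by rewrite !XA.
have [F FG' Fodd] := odd_spanning_subgraph evG'.
have [|F' F'G' F'P] := perfect_forest_below G'G _ FG' Fodd.
  by move=> x y xy Gxy; rewrite /= /r Gxy (inA _ _ xy) eqxx.
exists F' => //; apply/negP => /F'G'; rewrite /= /r uA (negPf vA).
by rewrite andbF.
Qed.

(** The set [reach2 h] can be left only through [h], so its union with what [h] reaches outside of
    it is closed under edges. *)
Lemma outside_connected h :
  h \in X -> X :\: reach2 h \subset reach G (X :\: reach2 h) h.
Proof.
move=> hX; set P := X :\: reach2 h.
have hP : h \in P by rewrite in_setD reach2_self.
have /subsetP sub : X \subset reach2 h :|: reach G P h.
  apply: X_min => [|a b].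
    by apply/setUP; have [->|/reach2_u] := eqVneq u h; [right; apply: reach_self|left].
  move=> /[swap] ab /setUP aR; apply/setUP.
  have [bR|bR] := boolP (b \in reach2 h); [by left | right].
  case: aR => aR.
    have [->|bh] := eqVneq b h; first exact: reach_self.
    by rewrite (reach2_step aR bh ab) in bR.
  have /setDP[aX _] := subsetP (reach_sub _ _ _) _ aR.
  by apply: (reach_step aR _ ab); rewrite in_setD bR (X_closed aX ab).
apply/subsetP => x /setDP[/sub/setUP[->//|]]; by [].
Qed.

Lemma avoid_at_end :
  even_components -> ~~ odd #|reach2 u| -> exists2 F, zero_perfect_forest G F & ~~ F u v.
Proof.
move=> evG evR; apply: (@forest_of_split (X :\: reach2 u) (reach2 u)) => //.
- by rewrite in_setD reach2_self.
- by rewrite reach2_v // eq_sym.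
- by rewrite disjoint_sym disjoints_subset setCD subsetUr.
- by rewrite setUC -{1}(setIidPr (reach2_sub u)) setID.
- exact: outside_connected.
(* With [u] deleted, the part reached from [u] is empty. *)
- have -> : reach2 u = reach G [set~ u] v.
    rewrite /reach2; case: (set_0Vmem (reach G [set~ u] u)) => [->|[x /reach_src]].
      by rewrite set0U.
    by rewrite !inE eqxx.
  exact: reach_idem.
by rewrite card_outside //; apply: (forallP evG).
Qed.

(* The case k = 2 of the fan version of Menger's theorem, for connected sets in
   place of paths. With B maximal, suppose B is not adjacent to h; a vertex x of
   the boundary of B with the largest side E x towards u then separates h from
   both u and v. *)
Lemma fan h : in_block h -> h != u -> h != v ->
  exists A B,
    [/\ [/\ u \in A, v \in B, [disjoint A & B], A \subset reach2 h
          & B \subset reach2 h],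
    A \subset reach G A u, B \subset reach G B v,
    exists2 a, a \in A & G a h & exists2 b, b \in B & G b h].
Proof.
move=> hH hu hv.
pose Q B := [&& v \in B, u \notin B, h \notin B, B \subset reach G B v
  & h \in reach G (~: B) u].
have Qv : Q [set v].
  apply/and5P; split; [by rewrite inE | by rewrite inE | by rewrite inE | | ].
    by rewrite sub1set reach_self ?inE.
  have := forallP hH v; rewrite eq_sym hv => /setUP[] // /reach_src.
  by rewrite !inE eqxx.
case: (arg_maxnP (fun B => #|B|) Qv) => B /and5P[vB uB hB cB hR] Bmax.
have [b bB bh] : exists2 b, b \in B & G b h.
  apply/exists_inP; apply: contraT => /exists_inPn nobh.
  pose bd x := (x \notin B) && [exists b in B, G b x].
  have bdu : bd u by rewrite /bd uB; apply/exists_inP; exists v; rewrite // adj_sym.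
  pose E x := reach G (~: B :\ x) u.
  case: (arg_maxnP (fun x => #|E x|) bdu) => x /andP[xB /exists_inP[b bB bx]] xmax.
  have xh : x != h by apply: contraTneq bx => ->; apply: nobh.
  (* Otherwise [x] could be added to [B], against the choice of [B]. *)
  have hE : h \notin E x.
    apply/negP => hE; have := reach_src hE; rewrite !inE eq_sym => /andP[xu _].
    have /Bmax : Q (x |: B).
      apply/and5P; split.
      - by rewrite in_setU1 vB orbT.
      - by rewrite in_setU1 negb_or uB eq_sym xu.
      - by rewrite in_setU1 negb_or hB eq_sym xh.
      - exact: reach_add bB bx.
      - by rewrite setCU setIC -setDE.
    by rewrite /geq /= leqNgt cardsU1 xB add1n ltnS leqnn.
  pose C := reach G (~: B :\ x) h.
  have hC : h \in C by rewrite reach_self // !inE eq_sym xh.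
  have uC : u \notin C by apply: contra hE; apply: reach_sym.
  (* A boundary vertex [z] in [C] would not lie in [E x]; then [E z] would contain [E x] and also
     [x], against the choice of [x]. *)
  have nobd z : z \in C -> ~~ bd z.
    move=> zC; apply/negP => bdz.
    have zx : z != x.
      apply: contraTneq (subsetP (reach_sub _ _ _) _ zC) => ->.
      by rewrite !inE eqxx.
    have zE : z \notin E x.
      by apply: contra uC => zE; apply: reach_trans zC (reach_sym zE).
    have sub : E x \subset E z.
      apply: subset_trans (reach_avoid zE) (reach_mono _ _ _).
      by apply/subsetP => w; rewrite !inE => /and3P[-> _ ->].
    have xW : x \in ~: B :\ z by rewrite !inE eq_sym zx.
    have xE : x \in E z.
      have [xu|xu] := eqVneq x u; first by rewrite /E -xu reach_self.
      have uW : u \in ~: B :\ h by rewrite !inE eq_sym hu.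
      have [a aE ax] : exists2 a, a \in E x & G a x.
        apply/exists_inP; apply: contraLR hR => /exists_inPn noax.
        suff /subsetP sub' : reach G (~: B) u \subset E x by apply: contra (sub' h) hE.
        apply: reach_min => [uB'|a c aB cB' aE ac].
          by apply: reach_self; rewrite !inE eq_sym xu.
        apply: (reach_step aE _ ac); rewrite in_setD1 cB' andbT.
        by apply: contraTneq ac => ->; apply: noax.
      exact: reach_step (subsetP sub _ aE) xW ax.
    have := xmax z bdz; rewrite /geq /= leqNgt => /negP[].
    apply: proper_card; apply/properP; split=> //; exists x => //.
    by apply/negP => /(subsetP (reach_sub _ _ _)); rewrite !inE eqxx.
  (* [B] can be entered only through its boundary, so deleting [x] alone confines [h] to [C], which
     contains neither [u] nor [v]. *)
  have /subsetP subC : reach G [set~ x] h \subset C.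
    apply: reach_min => // a c _ cW aC ac.
    have cx : c != x by rewrite -in_setC1.
    apply: (reach_step aC _ ac); rewrite !inE cx /=; apply/negP => cB'.
    have /negP[] := nobd a aC; apply/andP; split.
      by have /(subsetP (reach_sub _ _ _)) := aC; rewrite !inE => /andP[].
    by apply/exists_inP; exists c; rewrite // adj_sym.
  have := forallP hH x; rewrite xh => /setUP[] /reach_sym /subC; first by rewrite (negPf uC).
  by move/(subsetP (reach_sub _ _ _)); rewrite !inE vB andbF.
exists (reach G (~: B :\ h) u), B.
have uW : u \in ~: B :\ h by rewrite !inE eq_sym hu.
split=> //; first split=> //.
- exact: reach_self.
- rewrite -setI_eq0; apply/eqP/setP => x; rewrite !inE; apply/negP.
  by case/andP=> /andP[/andP[_ /negPf->]].
- apply: subset_trans (subsetUl _ _); apply: reach_mono.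
  by apply/subsetP => x; rewrite !inE => /andP[].
- apply: subset_trans (subsetUr _ _); apply: subset_trans cB (reach_mono _ _ _).
  by apply/subsetP => x xB; rewrite !inE; apply: contraNneq hB => <-.
- exact: reach_idem.
- exact: reach_exit.
by exists b.
Qed.

(** Among the pairs with the properties given by [fan], one with [#|A| + #|B|] maximal is taken: a
    vertex of [reach2 h] adjacent to [A :|: B] but outside it could be added to one side. *)
Lemma split_outside h : in_block h -> h != u -> h != v ->
  exists A B,
    [/\ [/\ u \in A, v \in B, [disjoint A & B] & A :|: B = reach2 h],
    A \subset reach G A u, B \subset reach G B v,
    exists2 a, a \in A & G a h & exists2 b, b \in B & G b h].
Proof.
move=> hH hu hv.
pose Q (p : {set T} * {set T}) :=
  [&& [&& u \in p.1, v \in p.2, [disjoint p.1 & p.2], p.1 \subset reach2 h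
    & p.2 \subset reach2 h],
  p.1 \subset reach G p.1 u, p.2 \subset reach G p.2 v,
  [exists a in p.1, G a h] & [exists b in p.2, G b h]].
have [A0 [B0 [[uA0 vB0 dAB0 A0R B0R] cA0 cB0 A0h B0h]]] := fan hH hu hv.
have Q0 : Q (A0, B0).
  by apply/and5P; split=> //; [apply/and5P; split|apply/exists_inP|apply/exists_inP].
case: (arg_maxnP (fun p : {set T} * {set T} => #|p.1| + #|p.2|) Q0) => -[A B] /=.
case/and5P=> /and5P[/= uA vB dAB AR BR] cA cB /= Ah Bh ABmax.
exists A, B; split=> //; [split=> // | exact/exists_inP | exact/exists_inP].
apply/eqP; rewrite eqEsubset subUset AR BR /=.
apply: reach2_min => [_|_|a b]; [by rewrite inE uA|by rewrite inE vB orbT|].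
move=> /[swap] bh /[swap] ab abAB; apply: contraT => bAB.
have [bA bB] : b \notin A /\ b \notin B by move: bAB; rewrite inE negb_or => /andP.
have mono (C : {set T}) : [exists a in C, G a h] -> [exists a in b |: C, G a h].
  by case/exists_inP=> c cC ch; apply/exists_inP; exists c; rewrite // inE cC orbT.
have bR : b \in reach2 h.
  apply: reach2_step ab => //; apply: subsetP abAB; by rewrite subUset AR.
case/setUP: abAB => aAB.
  have /ABmax : Q (b |: A, B).
    apply/and5P; split=> //=; last exact: mono; last exact: reach_add ab.
    apply/and5P; split=> //=; first by rewrite inE uA orbT.
      by rewrite disjoints_subset subUset sub1set in_setC bB -disjoints_subset.
    by rewrite subUset sub1set bR.
  by rewrite /geq /= cardsU1 bA ltnNge leqnn.
have /ABmax : Q (A, b |: B).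
  apply/and5P; split=> //=; last exact: mono; last exact: reach_add ab.
  apply/and5P; split=> //=; first by rewrite inE vB orbT.
    rewrite disjoint_sym disjoints_subset subUset sub1set in_setC bA.
    by rewrite -disjoints_subset disjoint_sym.
  by rewrite subUset sub1set bR.
by rewrite /geq /= cardsU1 bB addnCA ltnNge leqnn.
Qed.

(** The edge from [b] leads to [h], and from there [outside_connected] reaches the whole piece. *)
Lemma attach_outside h B s b :
    h \in X -> B \subset reach G B s -> b \in B -> G b h ->
  B :|: (X :\: reach2 h) \subset reach G (B :|: (X :\: reach2 h)) s.
Proof.
move=> hX cB bB bh; set P := X :\: reach2 h.
have sub := subset_trans cB (reach_mono G s (subsetUl B P)).
rewrite subUset sub /=; apply/subsetP => x /(subsetP (outside_connected hX)).
have hP : h \in B :|: P by rewrite in_setU in_setD reach2_self hX orbT.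
have hR := reach_step (subsetP sub _ bB) hP bh.
by move=> /(subsetP (reach_mono G h (subsetUr B P))); apply: reach_trans.
Qed.

End Characterization.

Lemma avoidable_forest (T : finType) (G : sgraph T) (u v : T) :
    G u v -> even_components G -> avoidable G u v ->
  exists2 F, zero_perfect_forest G F & ~~ F u v.
Proof.
move=> uv evG /orP[evR|]; first exact: avoid_at_end.
case/existsP=> h /and4P[hu hv oddR hH].
have hX := block_sub uv hH.
have [A [B [[uA vB dAB AB] cA cB [a aA ah] [b bB bh]]]] := split_outside uv hH hu hv.
pose X := reach G setT u; pose P := X :\: reach2 G u v h.
have dP (C : {set T}) : C \subset reach2 G u v h -> [disjoint C & P].
  by move=> CR; rewrite disjoints_subset setCD (subset_trans CR) ?subsetUr.
have XP : reach2 G u v h :|: P = X.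
  by rewrite /P setDE setUIr setUCr setIT; apply/setUidPr/reach2_sub.
(* As [#|reach2 h|] is odd, exactly one of [A] and [B] has odd order; that one receives [P]. *)
have [oddA|evA] := boolP (odd #|A|); last first.
  apply: (@forest_of_split _ G u v A (B :|: P)) => //.
  - by rewrite in_setU vB.
  - rewrite -setI_eq0 setIUr disjoint_setI0 // set0U setI_eq0 dP //.
    by rewrite -AB subsetUl.
  - by rewrite setUA AB XP.
  exact: attach_outside bB bh.
have dAP : [disjoint A :|: P & B].
  rewrite -setI_eq0 setIUl disjoint_setI0 // set0U setI_eq0 disjoint_sym dP //.
  by rewrite -AB subsetUr.
have XE : A :|: P :|: B = X by rewrite setUAC AB XP.
apply: (@forest_of_split _ G u v (A :|: P) B) => //.
- by rewrite in_setU uA.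
- exact: attach_outside aA ah.
have := forallP evG u; rewrite -/X -XE cardsU disjoint_setI0 // cards0 subn0 oddD.
move: oddR; rewrite -AB cardsU disjoint_setI0 // cards0 subn0 oddD oddA.
by case: (odd #|B|); rewrite ?addbF.
Qed.

Theorem avoiding_forestP (T : finType) (G : sgraph T) (u v : T) : G u v ->
  (exists F : sgraph T, zero_perfect_forest G F /\ ~~ F u v) <->
  even_components G && avoidable G u v.
Proof.
move=> uv; split=> [[F [FP Fuv]]|/andP[evG avG]]; first exact: forest_avoidable Fuv.
by have [F FP Fuv] := avoidable_forest uv evG avG; exists F.
Qed.

(** * Programs with bounded loops: semantics, running time, invariants *)

Lemma poly_nat_mono (p : {poly nat}) (m n : nat) :
  m <= n -> p.[m]%R <= p.[n]%R.
Proof.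
move=> mn; rewrite !horner_coef; apply: leq_sum => i _.
apply: leq_mul => //; elim: (i : nat) => // k IHk.
by rewrite !GRing.exprS; apply: leq_mul.
Qed.

(* Programs whose only loops are [PFor i p], where the counter [i] runs from 0 up to
   the value of register 1. Neither is assigned by the body of a well-formed loop,
   so programs are total functions on states, with a running time polynomial in
   register 1. *)
Inductive prog : Type :=
| PSet of nat & expr
| PStore of expr & expr
| PSeq of prog & prog
| PIf of expr & prog & prog
| PFor of nat & prog.

Fixpoint compile (p : prog) : cmd :=
  match p with
  | PSet r a => CSet r a
  | PStore a b => CStore a b
  | PSeq p q => CSeq (compile p) (compile q)
  | PIf a p q => CIf a (compile p) (compile q)
  | PFor i p =>
      CSeq (CSet i (ELit 0))
        (CWhile (ESub (EReg 1) (EReg i))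
          (CSeq (compile p) (CSet i (EAdd (EReg i) (ELit 1)))))
  end.

Fixpoint assigned (p : prog) : seq nat :=
  match p with
  | PSet r _ => [:: r]
  | PStore _ _ => [::]
  | PSeq p q | PIf _ p q => assigned p ++ assigned q
  | PFor i p => i :: assigned p
  end.

Fixpoint wf (p : prog) : bool :=
  match p with
  | PSet r _ => r != 1
  | PStore _ _ => true
  | PSeq p q | PIf _ p q => wf p && wf q
  | PFor i p => [&& i != 1, i \notin assigned p & wf p]
  end.

Definition set_reg (s : state) (r k : nat) : state :=
  State (update (regs s) r k) (memory s).

Fixpoint sem (p : prog) (s : state) : state :=
  match p with
  | PSet r a => set_reg s r (eval_expr s a)
  | PStore a b => State (regs s) (update (memory s) (eval_expr s a) (eval_expr s b))
  | PSeq p q => sem q (sem p s)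
  | PIf a p q => if eval_expr s a != 0 then sem p s else sem q s
  | PFor i p =>
      iter (regs s 1) (fun s' => set_reg (sem p s') i (regs (sem p s') i + 1))
        (set_reg s i 0)
  end.

(** Branches of a conditional are added, as a polynomial bound for their maximum. A loop round costs
    3 for the test, 4 for the increment and 1 for the loop step; the final test costs 4 and the
    initialization 2. *)
Fixpoint cost (p : prog) : {poly nat} :=
  match p with
  | PSet _ a => ((expr_cost a).+1)%:P
  | PStore a b => ((expr_cost a + expr_cost b).+1)%:P
  | PSeq p q => cost p + cost q
  | PIf a p q => ((expr_cost a).+1)%:P + (cost p + cost q)
  | PFor _ p => (cost p + 8%:P) * 'X + 6%:P
  end%R.

Lemma sem_frame r p s : r \notin assigned p -> regs (sem p s) r = regs s r.
Proof.
elim: p s => [i a|a b|p IHp q IHq|a p IHp q IHq|i p IHp] s //=.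
- by rewrite inE /update => /negPf->.
- by rewrite mem_cat negb_or => /andP[rp rq]; rewrite IHq // IHp.
- by rewrite mem_cat negb_or => /andP[rp rq]; case: ifP => _; [apply: IHp|apply: IHq].
rewrite inE negb_or => /andP[/negPf ri rp].
elim: (regs s 1) => [|k IHk] /=; first by rewrite /update ri.
by rewrite /update ri IHp.
Qed.

Lemma wf_bound p : wf p -> 1 \notin assigned p.
Proof.
elim: p => [i a|a b|p IHp q IHq|a p IHp q IHq|i p IHp] //=.
- by rewrite inE eq_sym.
- by case/andP=> /IHp p1 /IHq q1; rewrite mem_cat negb_or p1.
- by case/andP=> /IHp p1 /IHq q1; rewrite mem_cat negb_or p1.
by case/and3P=> i1 _ /IHp p1; rewrite inE negb_or eq_sym i1.
Qed.

Lemma exec_compile p s : wf p ->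
  exists2 t, exec (compile p) s t (sem p s) & (t <= (cost p).[regs s 1]%R)%N.
Proof.
elim: p s => [i a|a b|p IHp q IHq|a p IHp q IHq|i p IHp] s /=.
- by move=> _; exists (expr_cost a).+1; [apply: ExecSet|rewrite hornerC].
- by move=> _; exists (expr_cost a + expr_cost b).+1; [apply: ExecStore|rewrite hornerC].
- case/andP=> wp wq; have [t1 e1 l1] := IHp s wp; have [t2 e2 l2] := IHq (sem p s) wq.
  exists (t1 + t2); first exact: ExecSeq e1 e2.
  by rewrite hornerD leq_add // -(sem_frame s (wf_bound wp)).
- case/andP=> wp wq; rewrite !hornerD hornerC.
  have [t1 e1 l1] := IHp s wp; have [t2 e2 l2] := IHq s wq.
  have [a0|a0] := eqVneq (eval_expr s a) 0.
    exists (expr_cost a + t2).+1; first exact: ExecIfFalse.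
    by rewrite -addSn leq_add2l (leq_trans l2) // leq_addl.
  exists (expr_cost a + t1).+1; first exact: ExecIfTrue.
  by rewrite -addSn leq_add2l (leq_trans l1) // leq_addr.
case/and3P=> i1 ip wp; set body := fun s' : state => _.
pose loop := CWhile (ESub (EReg 1) (EReg i))
  (CSeq (compile p) (CSet i (EAdd (EReg i) (ELit 1)))).
set c := (cost p).[regs s 1]%R.
have body_regs s' : regs (body s') 1 = regs s' 1.
  by rewrite /= /update eq_sym (negPf i1) sem_frame // wf_bound.
have body_i s' : regs (body s') i = (regs s' i).+1.
  by rewrite /= /update eqxx sem_frame // addn1.
(* The induction is on [k], the number of iterations left. *)
have run k s' : regs s' 1 = regs s 1 -> regs s' i + k = regs s 1 ->
    exists2 t, exec loop s' t (iter k body s') & t <= k * (c + 8) + 4.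
  elim: k s' => [|k IHk] s' s1 si.
    exists 4 => //=; apply: ExecWhileStop => /=.
    by rewrite s1 -si addn0 subnn.
  have [t1 e1 l1] := IHp s' wp.
  have [t2 e2 l2] : exists2 t,
      exec loop (body s') t (iter k body (body s')) & t <= k * (c + 8) + 4.
    by apply: IHk; rewrite ?body_regs // body_i addSnnS.
  exists (3 + (t1 + 4) + t2).+1.
    rewrite iterSr; apply: ExecWhileStep e2.
      by rewrite /= s1 -si addKn.
    by apply: ExecSeq e1 _; apply: ExecSet.
  rewrite s1 in l1; rewrite -/c in l1; lia.
have [||t et lt] := run (regs s 1) (set_reg s i 0).
- by rewrite /= /update eq_sym (negPf i1).
- by rewrite /= /update eqxx.
exists (2 + t); first by apply: ExecSeq et; apply: ExecSet.
rewrite hornerD hornerMX hornerD !hornerC -/c.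
change (2 + t <= (c + 8) * regs s 1 + 6); lia.
Qed.

(** [I k] describes the state in which the counter has just become [k], so the premises include the
    assignment to the counter. *)
Lemma sem_for (I : nat -> state -> Prop) i p s :
    wf (PFor i p) -> I 0 (set_reg s i 0) ->
    (forall k s', k < regs s 1 -> regs s' i = k -> regs s' 1 = regs s 1 ->
       I k s' -> I k.+1 (set_reg (sem p s') i k.+1)) ->
  I (regs s 1) (sem (PFor i p) s).
Proof.
case/and3P=> i1 ip; rewrite -/wf => wp I0 IS /=; set body := fun s' : state => _.
suff: forall k, k <= regs s 1 -> let s' := iter k body (set_reg s i 0) in
    [/\ regs s' i = k, regs s' 1 = regs s 1 & I k s'] by case/(_ _ (leqnn _)).
elim=> [|k IHk] kn; first by rewrite /= /update eqxx eq_sym (negPf i1).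
have [] := IHk (ltnW kn); rewrite iterS; move: (iter k body _) => s' si s1 Ik.
have ri : regs (sem p s') i = k by rewrite sem_frame.
have r1 : regs (sem p s') 1 = regs s 1 by rewrite sem_frame // wf_bound.
rewrite /body ri addn1 /= /update eqxx eq_sym (negPf i1).
by split=> //; apply: IS.
Qed.

Lemma regs_set_reg s r k j :
  regs (set_reg s r k) j = if j == r then k else regs s j.
Proof. by []. Qed.

(** * Subroutines: marking reachable vertices and computing parities *)

(* Registers: 0 holds 3 + n ^ 2, the address just after the input, where a table of
   n marks is kept; 1 holds n; 2 and 3 hold the ends of the edge; 4 to 8 are working
   registers of [mark_reachable] and [parity], and 8 holds the result of the latter.
   The main program uses 9 and 10 as counters and 11, 12 and 13 for results. *)
Definition cell (r : nat) : expr := EAdd (EReg 0) (EReg r).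

(** With truncated subtraction this is the absolute difference, nonzero exactly when the registers
    differ. *)
Definition dist (r r' : nat) : expr :=
  EAdd (ESub (EReg r) (EReg r')) (ESub (EReg r') (EReg r)).

(** A self-assignment in the role of the empty command. *)
Definition skip : prog := PSet 8 (EReg 8).

Definition clear_marks : prog := PFor 4 (PStore (cell 4) (ELit 0)).

(* Register 7 scans the adjacency matrix: it holds the address 3 + (i * n + j) of the
   entry given by the registers 4 and 5. *)
Definition relax (y : nat) : prog :=
  PSeq
    (PIf (ESub (EAdd (EMem (EReg 7)) (EMem (cell 4))) (ELit 1))
      (PIf (dist 5 y) (PStore (cell 5) (ELit 1)) skip) skip)
    (PSet 7 (EAdd (EReg 7) (ELit 1))).

Definition relax_rows (y : nat) : prog := PFor 4 (PFor 5 (relax y)).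

Definition relax_all (y : nat) : prog := PSeq (PSet 7 (ELit 3)) (relax_rows y).

(* Marks the vertices reachable from [a] or [b] after deletion of [y]; for [y] = n,
   nothing is deleted and the mark of [y] lies outside the table. *)
Definition mark_reachable (y a b : nat) : prog :=
  PSeq clear_marks
    (PSeq (PStore (cell a) (ELit 1))
      (PSeq (PStore (cell b) (ELit 1))
        (PSeq (PStore (cell y) (ELit 0)) (PFor 6 (relax_all y))))).

(** On bits, the absolute difference is exclusive or. *)
Definition flip_marks : prog :=
  PFor 4 (PSet 8 (EAdd (ESub (EReg 8) (EMem (cell 4)))
                       (ESub (EMem (cell 4)) (EReg 8)))).

Definition parity : prog := PSeq (PSet 8 (ELit 0)) flip_marks.

Lemma dist_neq0 (a b : nat) : (a - b + (b - a) != 0) = (a != b).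
Proof. by rewrite addn_eq0 !subn_eq0 -eqn_leq. Qed.

Lemma ltn_pair (n : nat) (i j : 'I_n) : i * n + j < n * n.
Proof. by have := ltn_ord i; have := ltn_ord j; nia. Qed.

Lemma pair_inj (n : nat) (i j a b : 'I_n) : i * n + j = a * n + b -> i = a /\ j = b.
Proof.
move=> e; have n0 : 0 < n by apply: leq_ltn_trans (ltn_ord i).
have := congr1 (modn^~ n) e; have := congr1 (divn^~ n) e.
rewrite /= !modnMDl !modn_small // !divnMDl // !divn_small // !addn0.
by move=> /val_inj-> /val_inj->.
Qed.

(** * Correctness of the subroutines *)

Section Memory.
Variables (n : nat) (G : sgraph 'I_n) (u v : 'I_n).
Implicit Types (s : state) (M : {set 'I_n}).

Definition ready s : Prop :=
  [/\ regs s 0 = 3 + n * n, regs s 1 = n, regs s 2 = u, regs s 3 = v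
    & forall i j : 'I_n, memory s (3 + (i * n + j)) = G i j].

Definition marks s M : Prop := forall i : 'I_n, memory s (3 + n * n + i) = (i \in M).

Lemma ready_set_reg s r k : 3 < r -> ready s -> ready (set_reg s r k).
Proof. by move=> r3 [s0 s1 s2 s3 sG]; split; rewrite //= /update ifN //; lia. Qed.

Lemma ready_store s k m :
  ready s -> ready (State (regs s) (update (memory s) (3 + n * n + k) m)).
Proof.
case=> s0 s1 s2 s3 sG; split=> //= i j; rewrite /update ifN //.
by have := ltn_pair i j; lia.
Qed.

Lemma marks_store s M (j : 'I_n) (b : bool) : marks s M ->
  marks (State (regs s) (update (memory s) (3 + n * n + j) b))
    (if b then j |: M else M :\ j).
Proof.
move=> sM i; rewrite /= /update eqn_add2l (inj_eq val_inj) sM.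
by case: b; rewrite !inE; case: eqVneq.
Qed.

Lemma marks_store_out s M k m : n <= k -> marks s M ->
  marks (State (regs s) (update (memory s) (3 + n * n + k) m)) M.
Proof.
move=> nk sM i; rewrite /= /update eqn_add2l ifN //.
by have := ltn_ord i; lia.
Qed.

Lemma sem_clear_marks s :
  ready s -> ready (sem clear_marks s) /\ marks (sem clear_marks s) set0.
Proof.
move=> rs; have [_ s1 _ _ _] := rs.
pose I k s' := ready s' /\ forall i : 'I_n, i < k -> memory s' (3 + n * n + i) = 0.
have [] : I (regs s 1) (sem clear_marks s).
  apply: (@sem_for I); [by [] | by split=> //; apply: ready_set_reg |].
  move=> k s' _ sk _ [rs' s'0] /=; have [-> _ _ _ _] := rs'.
  rewrite sk; split; first exact/ready_set_reg/ready_store.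
  move=> i; rewrite ltnS leq_eqVlt /= /update eqn_add2l.
  by case: eqVneq => //= _; apply: s'0.
by rewrite s1 => rs' s0; split=> // i; rewrite s0 ?inE.
Qed.

Lemma sem_parity s M : ready s -> marks s M ->
  [/\ ready (sem parity s), marks (sem parity s) M
    & regs (sem parity s) 8 = odd #|M|].
Proof.
move=> rs sM; set s0 := sem (PSet 8 (ELit 0)) s.
have rs0 : ready s0 by apply: ready_set_reg.
pose I k s' := [/\ ready s', marks s' M
  & regs s' 8 = odd (\sum_(i < n | i < k) (i \in M))].
rewrite -[sem parity s]/(sem flip_marks s0).
have [] : I (regs s0 1) (sem flip_marks s0).
  apply: (@sem_for I); first by [].
    by split; [apply: ready_set_reg | exact: sM | rewrite big_pred0].
  move=> k s' kn sk _ [rs' sM' s8] /=.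
  split; [by apply: ready_set_reg => //; apply: ready_set_reg | exact: sM' |].
  have [e0 _ _ _ _] := rs'; have [_ e1 _ _ _] := rs0.
  rewrite e1 in kn; rewrite /= /update /= e0 s8 sk (sM' (Ordinal kn)).
  rewrite [in RHS](bigD1 (Ordinal kn)) //= oddD.
  rewrite [in RHS](eq_bigl (fun i : 'I_n => i < k)); last first.
    by move=> i; rewrite -val_eqE /= ltnS ltn_neqAle andbC.
  by case: (odd _); case: (_ \in _).
have [_ -> _ _ _] := rs0; move=> rs' sM' ->; split=> //; congr (nat_of_bool (odd _)).
rewrite -sum1_card big_mkcond [RHS]big_mkcond; apply: eq_bigr => i _.
by rewrite ltn_ord; case: (i \in M).
Qed.

Section Closure.
Variables (y a b : nat) (a0 b0 : 'I_n) (y0 : nat).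
Hypothesis yr : y \notin [:: 4; 5; 6; 7; 8].

Let W : {set 'I_n} := [set z : 'I_n | z != y0 :> nat].
Let S0 : {set 'I_n} := [set a0; b0] :&: W.
Let R := reach G W a0 :|: reach G W b0.
(** One round of a breadth-first search; the starting vertices are always included, so that the
    iteration can begin at [set0]. *)
Let step M : {set 'I_n} := S0 :|: [set z in W | [exists x in M, G x z]].

Let R_step x z : x \in R -> z \in W -> G x z -> z \in R.
Proof.
by case/setUP=> xR zW xz; apply/setUP; [left|right]; apply: reach_step xR zW xz.
Qed.

Let S0_R : S0 \subset R.
Proof.
apply/subsetP => z /setIP[/set2P[]-> zW]; apply/setUP; [left|right]; exact: reach_self.
Qed.

Let step_mono : {homo step : M M' / M \subset M'}.
Proof.
move=> M M' MM'; apply/setUS/subsetP => z /setIdP[zW /exists_inP[x xM xz]].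
by rewrite inE zW; apply/exists_inP; exists x => //; apply: subsetP xM.
Qed.

(** A monotone operator on subsets of an [n]-element set, iterated from [set0], is stationary after
    [n] rounds; its fixed point contains [S0] and is closed under edges inside [W]. *)
Let R_fixset : R \subset iter n step set0.
Proof.
have -> : iter n step set0 = fixset step by rewrite /fixset card_ord.
have [S0F FS] : S0 \subset fixset step /\
    [set z in W | [exists x in fixset step, G x z]] \subset fixset step.
  by apply/andP; rewrite -subUset -/(step _) fixsetK.
have clF x z : x \in W -> z \in W -> x \in fixset step -> G x z -> z \in fixset step.
  move=> _ zW xF xz; apply: (subsetP FS); rewrite inE zW.
  by apply/exists_inP; exists x.
rewrite subUset; apply/andP; split; apply: reach_min => // zW; apply: (subsetP S0F);
by rewrite in_setI zW !inE eqxx ?orbT.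
Qed.

Lemma sem_relax s M (i j : 'I_n) :
    ready s -> marks s M -> regs s 4 = i -> regs s 5 = j ->
    regs s 7 = 3 + (i * n + j) -> regs s y = y0 ->
  [/\ ready (sem (relax y) s),
      marks (sem (relax y) s) (if [&& G i j, i \in M & j \in W] then j |: M else M)
    & regs (sem (relax y) s) 7 = 3 + (i * n + j).+1].
Proof.
move=> rs sM s4 s5 s7 sy; have [s0 _ _ _ sG] := rs.
pose s' := if [&& G i j, i \in M & j \in W] then
    State (regs s) (update (memory s) (3 + n * n + j) true)
  else s.
have [rs' sM' s'7] : [/\ ready s',
    marks s' (if [&& G i j, i \in M & j \in W] then j |: M else M) & regs s' 7 = regs s 7].
  rewrite /s'; case: ifP => // _; split=> //; first exact: ready_store.
  exact: (marks_store j true sM).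
have [s'' [-> rs'' sM'' s''7]] : exists s'', [/\ sem (relax y) s =
    set_reg s'' 7 (regs s'' 7 + 1), ready s'',
    marks s'' (if [&& G i j, i \in M & j \in W] then j |: M else M) & regs s'' 7 = regs s 7].
  (* For two bits, the sum minus 1 is nonzero exactly when both are 1. [skip] writes back the value
     of register 8. *)
  rewrite /relax; set p := PIf _ _ _; exists (sem p s); split=> //;
  move: rs' sM' s'7; rewrite /p /s' [sem _ _]/= s0 s4 s5 s7 sG sM sy dist_neq0 inE;
  by case: (G i j); case: (i \in M); case: (nat_of_ord j == y0) => //=
    rs' sM' s'7; rewrite ?s7 //; apply: ready_set_reg.
split; [exact: ready_set_reg | exact: sM'' |].
by rewrite /= /update /= s''7 s7 addn1 -addnS.
Qed.

(** Marks are updated in place, so one sweep may go further than one round of [step]. Hence the new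
    set is only bounded: below by the neighbours of [M] in [W], above by [R]. *)
Lemma sem_relax_all s M : ready s -> marks s M -> M \subset R -> regs s y = y0 ->
  [/\ ready (sem (relax_all y) s) & exists M',
    [/\ marks (sem (relax_all y) s) M', M \subset M', M' \subset R
      & forall x z, x \in M -> z \in W -> G x z -> z \in M']].
Proof.
move=> rs sM MR sy; set s0 := sem (PSet 7 (ELit 3)) s.
have frame r s' p : r \notin assigned p -> regs (sem p s') r = regs s' r by exact: sem_frame.
move: (yr); rewrite !inE !negb_or => /and5P[y4 y5 y6 y7 y8].
(* [q] counts the matrix entries already scanned, row by row. *)
pose J q s' := [/\ ready s', regs s' y = y0, regs s' 7 = 3 + q & exists M',
    [/\ marks s' M', M \subset M', M' \subset R
      & forall x z : 'I_n, x * n + z < q -> x \in M -> z \in W -> G x z -> z \in M']].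
have Jreg r k q s' : 3 < r -> r != 7 -> r != y -> J q s' -> J q (set_reg s' r k).
  move=> r3 r7 ry [rs' sy' s'7 [M' [sM' MM' M'R M'q]]]; split.
  - exact: ready_set_reg.
  - by rewrite /= /update eq_sym (negPf ry).
  - by rewrite /= /update eq_sym (negPf r7).
  by exists M'.
have [y4' y5'] : 4 != y /\ 5 != y by rewrite 2!(eq_sym _ y).
have J0 : J 0 s0.
  split; [exact: ready_set_reg | by rewrite /= /update (negPf y7) | by [] |].
  by exists M.
have e1 s' q : J q s' -> regs s' 1 = n by case=> -[].
rewrite -[sem _ s]/(sem (relax_rows y) s0).
have : J (regs s0 1 * n) (sem (relax_rows y) s0).
  apply: (@sem_for (fun k => J (k * n))).
  - by rewrite /=.
  - by apply Jreg.
  move=> i s' i_n s'4 s'1 Js'; apply Jreg => //.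
  have [//] : J (i * n + regs s' 1) (sem (PFor 5 (relax y)) s') /\
      regs (sem (PFor 5 (relax y)) s') 4 = i.
    apply: (@sem_for (fun k s' => J (i * n + k) s' /\ regs s' 4 = i)) => //.
      by rewrite addn0; split=> //; apply Jreg.
    move=> j s2 j_n s25 s21 [Js2 s24].
    rewrite (e1 _ _ J0) in i_n; rewrite (e1 _ _ Js') in j_n.
    have [rs2 s2y s27 [M' [sM' MM' M'R M'q]]] := Js2.
    have [rs3 sM3 s37] := sem_relax (i := Ordinal i_n) (j := Ordinal j_n)
      rs2 sM' s24 s25 s27 s2y.
    split; last exact: etrans (frame 4 s2 (relax y) isT) s24.
    apply Jreg => //; split=> //.
    - by rewrite frame //= !inE !negb_or y7 y8.
    - by rewrite s37 (addnS (i * n)).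
    exists (if [&& G (Ordinal i_n) (Ordinal j_n), Ordinal i_n \in M' & Ordinal j_n \in W]
      then Ordinal j_n |: M' else M'); split=> //.
    - by case: ifP => // _; apply: subset_trans MM' (subsetUr _ _).
    - case: ifP => // /and3P[ij iM jW]; rewrite subUset M'R andbT sub1set.
      by apply: R_step ij; rewrite // (subsetP M'R).
    move=> x z; rewrite addnS ltnS leq_eqVlt => /orP[/eqP xz|xz] xM zW Gxz; last first.
      by have := M'q x z xz xM zW Gxz; case: ifP => // _; rewrite inE orbC => ->.
    have [ex ez] := @pair_inj _ x z (Ordinal i_n) (Ordinal j_n) xz; subst x z.
    by rewrite Gxz zW (subsetP MM') // setU11.
  by rewrite (e1 _ _ Js') mulSn addnC.
rewrite (e1 _ _ J0) => -[rs' _ _ [M' [sM' MM' M'R M'q]]]; split=> //.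
by exists M'; split=> // x z; apply: M'q; apply: ltn_pair.
Qed.

Lemma sem_mark_reachable s : ready s -> regs s y = y0 -> regs s a = a0 -> regs s b = b0 ->
    a \notin [:: 4; 5; 6; 7; 8] -> b \notin [:: 4; 5; 6; 7; 8] ->
  ready (sem (mark_reachable y a b) s) /\ marks (sem (mark_reachable y a b) s) R.
Proof.
move=> rs sy sa sb ar br.
have frame r s' p : r \notin assigned p -> regs (sem p s') r = regs s' r by exact: sem_frame.
have [rs1 sM1] := sem_clear_marks rs.
have [r4 [a4 b4]] : y != 4 /\ a != 4 /\ b != 4.
  by move: yr ar br; rewrite !inE !negb_or => /andP[-> _] /andP[-> _] /andP[-> _].
set s1 := sem clear_marks s in rs1 sM1.
have [s1y s1a s1b] : [/\ regs s1 y = y0, regs s1 a = a0 & regs s1 b = b0].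
  by rewrite !frame //= inE.
(* The mark of the deleted vertex is cleared last, which removes it even when it is one of the
   starting vertices. *)
pose s2 := sem (PStore (cell y) (ELit 0)) (sem (PStore (cell b) (ELit 1))
  (sem (PStore (cell a) (ELit 1)) s1)).
have [rs2 sM2 s2y] : [/\ ready s2, marks s2 S0 & regs s2 y = y0].
  have [e0 _ _ _ _] := rs1; rewrite /s2 /= e0 s1a s1b s1y; split=> //.
    exact: (ready_store y0 0 (ready_store b0 1 (ready_store a0 1 rs1))).
  have sM3 := marks_store b0 true (marks_store a0 true sM1).
  have [y0n|ny0] := ltnP y0 n.
    rewrite (_ : S0 = (b0 |: (a0 |: set0)) :\ Ordinal y0n).
      exact: (marks_store (Ordinal y0n) false sM3).
    apply/setP => z; rewrite !inE -[z == Ordinal _]val_eqE /= orbF andbC.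
    by rewrite [(z == b0) || _]orbC.
  rewrite (_ : S0 = b0 |: (a0 |: set0)); first exact: marks_store_out ny0 sM3.
  apply/setP => z; rewrite !inE orbF [(z == b0) || _]orbC ltn_eqF ?andbT //.
  exact: leq_trans (ltn_ord z) ny0.
(* After [k] sweeps the marks lie between the [k]-th iterate of [step] and [R]; at [k = n] the two
   bounds meet by [R_fixset]. *)
pose I k s' := [/\ ready s', regs s' y = y0 & exists M,
  [/\ marks s' M, S0 \subset M, iter k step set0 \subset M & M \subset R]].
have : I (regs s2 1) (sem (PFor 6 (relax_all y)) s2).
  move: (yr); rewrite !inE !negb_or => /and5P[y4 y5 y6 y7 y8].
  apply: (@sem_for I); first by [].
    split; [exact: ready_set_reg | by rewrite /= /update (negPf y6) |].
    by exists S0; split=> //; apply: sub0set.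
  move=> k s' _ _ _ [rs' s'y [M [sM S0M kM MR]]].
  have [rs'' [M' [sM' MM' M'R M'step]]] := sem_relax_all rs' sM MR s'y.
  split; first exact: ready_set_reg.
    by rewrite regs_set_reg (negPf y6) frame //= !inE !negb_or y4 y5 y7 y8.
  exists M'; split=> //; first exact: subset_trans MM'.
  rewrite /= subUset (subset_trans S0M MM') /=; apply/subsetP => z.
  case/setIdP=> zW /exists_inP[x xk xz]; apply: M'step zW xz; exact: subsetP kM _ xk.
have [_ -> _ _ _] := rs2; case=> rs' _ [M [sM _ nM MR]]; split=> //.
suff -> : R = M by [].
by apply/eqP; rewrite eqEsubset MR (subset_trans R_fixset).
Qed.

End Closure.
End Memory.

(** * The decision program *)

Definition check_even : prog :=
  PSeq (PSet 11 (ELit 1))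
    (* Register 1 holds [n], so no vertex is deleted. *)
    (PFor 9 (PSeq (mark_reachable 1 9 9)
      (PSeq parity (PIf (EReg 8) (PSet 11 (ELit 0)) skip)))).

Definition check_end : prog :=
  PSeq (mark_reachable 2 2 3) (PSeq parity (PSet 12 (ESub (ELit 1) (EReg 8)))).

Definition check_block : prog :=
  PSeq (PSet 13 (ELit 1))
    (PFor 10 (PIf (dist 10 9)
      (PSeq (mark_reachable 10 2 3) (PIf (EMem (cell 9)) skip (PSet 13 (ELit 0))))
      skip)).

Definition check_inner : prog :=
  PFor 9 (PIf (dist 9 2)
    (PIf (dist 9 3)
      (PSeq (mark_reachable 9 2 3)
        (PSeq parity
          (PIf (EReg 8)
            (PSeq check_block (PIf (EReg 13) (PSet 12 (ELit 1)) skip))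
            skip)))
      skip)
    skip).

Definition decide_prog : prog :=
  PSeq check_even (PSeq check_end (PSeq check_inner
    (PIf (EReg 11) (PSet 0 (EReg 12)) (PSet 0 (ELit 0))))).

(** * Correctness of the decision program *)

Lemma forall_lt0 n (P : pred 'I_n) : [forall i : 'I_n, (i < 0) ==> P i].
Proof. by apply/forallP. Qed.

Lemma forall_ltS n k (kn : k < n) (P : pred 'I_n) :
  [forall i : 'I_n, (i < k.+1) ==> P i] =
  [forall i : 'I_n, (i < k) ==> P i] && P (Ordinal kn).
Proof.
apply/forallP/andP => [all|[/forallP all Pk] i].
  split; last by have := all (Ordinal kn); rewrite /= ltnSn.
  by apply/forallP => i; apply/implyP => ik; have := all i; rewrite ltnS ltnW.
apply/implyP; rewrite ltnS leq_eqVlt.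
case/orP=> [/eqP ik|ik]; last by have := all i; rewrite ik.
by rewrite (_ : i = Ordinal kn) //; apply: val_inj.
Qed.

Lemma exists_ltS n k (kn : k < n) (P : pred 'I_n) :
  [exists i : 'I_n, (i < k.+1) && P i] =
  [exists i : 'I_n, (i < k) && P i] || P (Ordinal kn).
Proof.
apply: negb_inj; rewrite negb_or !negb_exists.
have E m : [forall i : 'I_n, ~~ ((i < m) && P i)] = [forall i : 'I_n, (i < m) ==> ~~ P i].
  by apply: eq_forallb => i; rewrite negb_and implybE.
by rewrite !E (forall_ltS kn (fun i => ~~ P i)).
Qed.

Section Algorithm.
Variables (n : nat) (G : sgraph 'I_n) (u v : 'I_n).
Implicit Types (s : state) (x y h : 'I_n).

Local Notation ready := (ready G u v).

Lemma sem_mark_component s x : ready s -> regs s 9 = x ->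
  ready (sem (mark_reachable 1 9 9) s) /\
  marks (sem (mark_reachable 1 9 9) s) (reach G setT x).
Proof.
move=> rs s9; have [_ s1 _ _ _] := rs.
have [//|rs' sM] := sem_mark_reachable (y := 1) isT rs s1 s9 s9 isT; split=> //.
rewrite setUid in sM.
rewrite (_ : setT = [set z : 'I_n | z != n :> nat]) //.
by apply/setP => z; rewrite !inE ltn_eqF.
Qed.

Lemma sem_mark_reach2 s r x :
    ready s -> regs s r = x -> r \notin [:: 4; 5; 6; 7; 8] ->
  ready (sem (mark_reachable r 2 3) s) /\
  marks (sem (mark_reachable r 2 3) s) (reach2 G u v x).
Proof.
move=> rs sr rN; have [_ _ s2 s3 _] := rs.
have [//|rs' sM] := sem_mark_reachable rN rs sr s2 s3 isT; split=> //.
rewrite /reach2 (_ : [set~ x] = [set z : 'I_n | z != x :> nat]) //.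
by apply/setP => z; rewrite !inE.
Qed.

Lemma sem_check_even s : ready s ->
  ready (sem check_even s) /\ regs (sem check_even s) 11 = even_components G.
Proof.
move=> rs; pose s0 := set_reg s 11 1; have rs0 : ready s0 by apply: ready_set_reg.
pose P x := ~~ odd #|reach G setT x|.
pose I k s' := ready s' /\ regs s' 11 = [forall x : 'I_n, (x < k) ==> P x].
pose body := PSeq (mark_reachable 1 9 9)
  (PSeq parity (PIf (EReg 8) (PSet 11 (ELit 0)) skip)).
rewrite -[sem check_even s]/(sem (PFor 9 body) s0).
have [_ s01 _ _ _] := rs0.
have [] : I (regs s0 1) (sem (PFor 9 body) s0).
  apply: (@sem_for I); first by [].
    split; first exact: ready_set_reg.
    by rewrite forall_lt0.
  move=> k s' kn s'9 _ [rs' s'11]; rewrite s01 in kn.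
  have [rs1 sM1] := sem_mark_component rs' (s'9 : regs s' 9 = Ordinal kn).
  have [rs2 _ s28] := sem_parity rs1 sM1.
  set s2 := sem parity _ in rs2 s28.
  have s211 : regs s2 11 = regs s' 11 by rewrite /s2 !sem_frame.
  rewrite -[sem body s']/(sem (PIf (EReg 8) (PSet 11 (ELit 0)) skip) s2).
  have -> : sem (PIf (EReg 8) (PSet 11 (ELit 0)) skip) s2 =
    if ~~ P (Ordinal kn) then set_reg s2 11 0 else set_reg s2 8 (regs s2 8).
    by rewrite /= s28 negbK; case: odd.
  rewrite /I forall_ltS; case: (P _) => /=; rewrite /update /=.
    by split; [do 2![apply: ready_set_reg => //]|rewrite s211 s'11 andbT].
  by split; [do 2![apply: ready_set_reg => //]|rewrite andbF].
rewrite s01 => rs' ->; split=> //; congr nat_of_bool; apply: eq_forallb => x.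
by rewrite ltn_ord.
Qed.

Lemma sem_check_end s : ready s ->
  ready (sem check_end s) /\ regs (sem check_end s) 12 = ~~ odd #|reach2 G u v u|.
Proof.
move=> rs; have [_ _ s2 _ _] := rs.
have [rs1 sM1] := sem_mark_reach2 rs s2 isT.
have [rs2 _ s28] := sem_parity rs1 sM1.
split; first exact: ready_set_reg.
by rewrite [regs _ _]/(1 - regs _ 8) s28; case: odd.
Qed.

Lemma sem_check_block s h : ready s -> regs s 9 = h ->
  ready (sem check_block s) /\ regs (sem check_block s) 13 = in_block G u v h.
Proof.
move=> rs s9; pose s0 := set_reg s 13 1; have rs0 : ready s0 by apply: ready_set_reg.
pose P y := (y != h) ==> (h \in reach2 G u v y).
pose I k s' := [/\ ready s', regs s' 9 = h
  & regs s' 13 = [forall y : 'I_n, (y < k) ==> P y]].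
pose test := PIf (EMem (cell 9)) skip (PSet 13 (ELit 0)).
pose body := PIf (dist 10 9) (PSeq (mark_reachable 10 2 3) test) skip.
rewrite -[sem check_block s]/(sem (PFor 10 body) s0).
have [_ s01 _ _ _] := rs0.
have [] : I (regs s0 1) (sem (PFor 10 body) s0).
  apply: (@sem_for I); first by [].
    split; [exact: ready_set_reg | by [] |].
    by rewrite forall_lt0.
  move=> k s' kn s'10 _ [rs' s'9 s'13]; rewrite s01 in kn.
  suff [rs2 s213] : ready (sem body s') /\
      regs (sem body s') 13 = [forall y : 'I_n, (y < k) ==> P y] && P (Ordinal kn).
    split; [exact: ready_set_reg| |by rewrite regs_set_reg /= s213 forall_ltS].
    exact: etrans (sem_frame s' (isT : 9 \notin assigned body)) s'9.
  have -> : sem body s' = if k != h then sem test (sem (mark_reachable 10 2 3) s')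
      else set_reg s' 8 (regs s' 8).
    by rewrite /body [LHS]/= s'10 s'9 dist_neq0.
  have -> : P (Ordinal kn) = (k != h) ==> (h \in reach2 G u v (Ordinal kn)).
    by rewrite /P -val_eqE.
  case: ifP => _; last by split; [apply: ready_set_reg | rewrite andbT].
  rewrite implyTb.
  have [rs1 sM1] := sem_mark_reach2 rs' (s'10 : regs s' 10 = Ordinal kn) isT.
  set s1 := sem (mark_reachable 10 2 3) s' in rs1 sM1 *.
  have [s19 s113] : regs s1 9 = h /\ regs s1 13 = regs s' 13 by rewrite /s1 !sem_frame.
  have -> : sem test s1 = if h \in reach2 G u v (Ordinal kn)
      then set_reg s1 8 (regs s1 8) else set_reg s1 13 0.
    have [s10 _ _ _ _] := rs1.
    by rewrite [LHS]/= s10 s19 sM1; case: (h \in _).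
  case: (h \in _).
    by split; [apply: ready_set_reg | rewrite regs_set_reg /= s113 s'13 andbT].
  by split; [apply: ready_set_reg | rewrite andbF].
rewrite s01 => rs' _ ->; split=> //; congr nat_of_bool; apply: eq_forallb => y.
by rewrite ltn_ord.
Qed.

(** Register 12 enters with the verdict of [check_end], here [b], and the loop can only raise it to
    1; this gives the disjunction in [avoidable]. *)
Lemma sem_check_inner s (b : bool) : ready s -> regs s 12 = b ->
  ready (sem check_inner s) /\
  regs (sem check_inner s) 12 =
    b || [exists h, [&& h != u, h != v, odd #|reach2 G u v h| & in_block G u v h]].
Proof.
move=> rs s12; have [_ s1 _ _ _] := rs.
pose P h := [&& h != u, h != v, odd #|reach2 G u v h| & in_block G u v h].
pose I k s' := ready s' /\ regs s' 12 = b || [exists h : 'I_n, (h < k) && P h].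
pose set_good := PIf (EReg 13) (PSet 12 (ELit 1)) skip.
pose in_odd := PIf (EReg 8) (PSeq check_block set_good) skip.
pose test := PSeq (mark_reachable 9 2 3) (PSeq parity in_odd).
pose body := PIf (dist 9 2) (PIf (dist 9 3) test skip) skip.
have readyS s' r k : 3 < r -> ready s' -> ready (set_reg s' r k) by apply: ready_set_reg.
rewrite -[sem check_inner s]/(sem (PFor 9 body) s).
have [] : I (regs s 1) (sem (PFor 9 body) s).
  apply: (@sem_for I); first by [].
    split; first exact: readyS.
    by rewrite regs_set_reg /= s12; case: existsP => [[]|]; rewrite ?orbF.
  move=> k s' kn s'9 _ [rs' s'12]; rewrite s1 in kn.
  pose h := Ordinal kn.
  suff [rs2 s212] : ready (sem body s') /\
      regs (sem body s') 12 = (b || [exists h : 'I_n, (h < k) && P h]) || P h.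
    by split; [exact: readyS | rewrite regs_set_reg /= s212 exists_ltS orbA].
  have -> : sem body s' = if (h != u) && (h != v) then sem test s'
      else set_reg s' 8 (regs s' 8).
    have [_ _ s'2 s'3 _] := rs'.
    rewrite /body [LHS]/= s'9 s'2 s'3 !dist_neq0 -!val_eqE /=.
    by case: (k != u); case: (k != v).
  rewrite {2}/P andbA; case: ifP => _; last by split; [apply: readyS | rewrite orbF].
  rewrite andTb.
  have [rs1 sM1] := sem_mark_reach2 rs' (s'9 : regs s' 9 = h) isT.
  have [rs2 _ s28] := sem_parity rs1 sM1.
  rewrite -[sem test s']/(sem in_odd (sem parity (sem (mark_reachable 9 2 3) s'))).
  set s2 := sem parity _ in rs2 s28 *.
  have [s29 s212] : regs s2 9 = h /\ regs s2 12 = regs s' 12.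
    by rewrite /s2 !sem_frame.
  have -> : sem in_odd s2 = if odd #|reach2 G u v h|
      then sem set_good (sem check_block s2) else set_reg s2 8 (regs s2 8).
    by rewrite /in_odd [LHS]/= s28; case: odd.
  case: ifP => _; last by split; [apply: readyS | rewrite andFb orbF -s'12 -s212].
  rewrite andTb.
  have [rs3 s313] := sem_check_block rs2 s29.
  have s312 : regs (sem check_block s2) 12 = regs s2 12 by rewrite sem_frame.
  move: (sem check_block s2) rs3 s313 s312 => s3 rs3 s313 s312.
  rewrite /= s313; case: (in_block G u v h) => /=.
    by split; [apply: readyS | rewrite orbT].
  by split; [apply: readyS | rewrite /update /= s312 s212 s'12 orbF].
rewrite s1 => rs' ->; split=> //; congr (nat_of_bool (_ || _)); apply: eq_existsb => h.
by rewrite ltn_ord.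
Qed.

Lemma sem_decide s : ready s ->
  accepting (sem decide_prog s) <-> even_components G && avoidable G u v.
Proof.
move=> rs; have [rs1 s111] := sem_check_even rs.
have [rs2 s212] := sem_check_end rs1.
have [rs3 s312] := sem_check_inner rs2 s212.
rewrite -[sem decide_prog s]/(sem (PIf (EReg 11) (PSet 0 (EReg 12)) (PSet 0 (ELit 0)))
  (sem check_inner (sem check_end (sem check_even s)))).
have s311 : regs (sem check_inner (sem check_end (sem check_even s))) 11 =
    regs (sem check_even s) 11 by rewrite 2?sem_frame.
move: (sem check_inner _) rs3 s312 s311 => s3 rs3 s312 s311.
rewrite /accepting /= s311 s111 -/(avoidable G u v); case: (even_components G) => //=.
by rewrite /update /= s312 eqb0 negbK.
Qed.

End Algorithm.

(** * The input encoding and the polynomial time bound *)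

Lemma nth_flatten_uniform (T : Type) (x0 : T) (n : nat) (ss : seq (seq T)) i j :
    all (fun r => size r == n) ss -> i < size ss -> j < n ->
  nth x0 (flatten ss) (i * n + j) = nth x0 (nth [::] ss i) j.
Proof.
move=> + + jn; elim: ss i => [|r ss IHss] [|i] //= /andP[/eqP rn ssn].
  by move=> _; rewrite nth_cat rn jn.
by rewrite ltnS => iss; rewrite nth_cat rn mulSn -addnA ltnNge leq_addr addKn IHss.
Qed.

Section Encoding.
Variable x : graph_edge.
Let n := nb_vertices x.
Let w := encode_graph_edge x.

Lemma nth_encode (i j : 'I_n) :
  nth 0 w (3 + (i * n + j)) = input_graph x i j.
Proof.
rewrite -[LHS]/(nth 0 [seq nat_of_bool (input_graph x a b) |
  a <- enum 'I_n, b <- enum 'I_n] (i * n + j)).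
rewrite nth_flatten_uniform ?size_map -?enumT ?size_enum_ord //.
  rewrite (nth_map i) ?size_enum_ord // (nth_map j) ?size_enum_ord //.
  by rewrite !nth_ord_enum.
by apply/allP => r /mapP[k _ ->]; rewrite size_map size_enum_ord.
Qed.

Lemma size_encode : size w = 3 + n * n.
Proof. by rewrite size_cat size_allpairs -cardE card_ord. Qed.

(** Every entry of the input counts for at least one bit. This turns the time bound in [n] into one
    in the input size. *)
Lemma nb_vertices_le_input_size : n <= input_size w.
Proof.
apply: (@leq_trans (size w)); first by rewrite size_encode; nia.
by rewrite -sum1_size; apply: leq_sum.
Qed.

End Encoding.

Theorem theorem8 :
  polytime_decidable encode_graph_edge
    (fun x : graph_edge =>
       exists F : sgraph 'I_(nb_vertices x),
         zero_perfect_forest (input_graph x) F /\ ~~ F (end1 x) (end2 x)).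
Proof.
(* Register 0 already holds the input length [3 + n * n], the address of the table of marks; the
   three assignments load [n] and the ends of the edge. *)
exists (CSeq (CSet 1 (EMem (ELit 0))) (CSeq (CSet 2 (EMem (ELit 1)))
  (CSeq (CSet 3 (EMem (ELit 2))) (compile decide_prog)))).
(* Each of the three loading assignments takes 3 steps. *)
exists (9%:P + cost decide_prog)%R => x.
pose n := nb_vertices x; pose w := encode_graph_edge x.
pose s := set_reg (set_reg (set_reg (init_state w) 1 n) 2 (end1 x)) 3 (end2 x).
have rs : ready (input_graph x) (end1 x) (end2 x) s.
  by split=> // [|i j]; [exact: size_encode | exact: nth_encode].
have [t et lt] := exec_compile s (isT : wf decide_prog).
exists (3 + (3 + (3 + t))), (sem decide_prog s); split.
- by do 3![apply: ExecSeq; first exact: ExecSet].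
- rewrite hornerD hornerC !addnA leq_add2l (leq_trans lt) //.
  exact/poly_nat_mono/nb_vertices_le_input_size.
rewrite (sem_decide rs); apply: iff_sym; apply: avoiding_forestP; exact: is_edge.
Qed.
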